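(* Let $X$ be a Banach space of finite cotype with $\mathrm{GL}_2$ and let $E\subseteq X$ be a subspace. Then the following statements are equivalent: (i) $E$ has $\mathrm{GL}_2$. (ii) Every operator $T\in\Pi_1(E,\ell_2)$ admits an extension $\widetilde{T}\in\Pi_1(X,\ell_2)$.
   Context: Subspaces are closed linear subspaces. $\Pi_1(X,Y)$ is the space of 1-summing operators from $X$ to $Y$ with 1-summing norm $\pi_1$. An operator $T:Z\to Y$ between Banach spaces factors through $L_1$ if $T=BA$ with $A: Z\to L_1(\nu)$, $B:L_1(\nu)\to Y$ bounded for some measure $\nu$, and $\gamma_1(T)=\inf\|A\|\|B\|$ over all such factorizations. A Banach space $Z$ has $\mathrm{GL}_2$ if every 1-summing operator from $Z$ to $\ell_2$ factors through $L_1$; equivalently, there is a constant $K$ with $\gamma_1(T)\le K\pi_1(T)$ for all finite rank $T:Z\to\ell_2$. *)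

(* Defs.v *)
From HB Require Import structures.
From mathcomp Require Import all_boot all_order all_algebra.
From mathcomp Require Import all_classical all_reals all_analysis.
From mathcomp Require Import measurable_realfun ess_sup_inf.

Set Implicit Arguments.
Unset Strict Implicit.
Unset Printing Implicit Defensive.

Import Order.TTheory GRing.Theory Num.Theory.
Import numFieldNormedType.Exports.

Local Open Scope classical_set_scope.
Local Open Scope ring_scope.

(** MathComp-Analysis leaves [LspaceType mu p1], the a.e.-classes of measurable
functions with finite [p]-norm, without algebraic structure; it gets here the
vector space operations induced by pointwise operations on representatives,
and the [L_p] norm. *)

Section Lspace_normed.
Context d (T : measurableType d) (R : realType).
Context (mu : {measure set T -> \bar R}) (p : \bar R) (p1 : (1 <= p)%E).
Implicit Types (f g h : LfunType mu p1) (F G H : LspaceType mu p1).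

Lemma Lnorm_ae_eq (f g : T -> R) :
  measurable_fun setT f -> measurable_fun setT g -> f = g %[ae mu] ->
  ('N[mu]_p[EFin \o f] = 'N[mu]_p[EFin \o g])%E.
Proof.
move=> mf mg fg; rewrite unlock /Lnorm; case: p p1 => [r _|_|//].
  have mpow (h : T -> R) : measurable_fun setT h ->
      measurable_fun setT ((fun x => `|(h x)%:E| `^ r)%E : T -> \bar R).
    move=> mh; apply: (measurableT_comp (measurable_poweR r)) => //.
    by apply: measurableT_comp => //; exact/measurable_EFinP.
  congr (_ `^ _)%E; apply: ae_eq_integral => //; [exact: mpow|exact: mpow|].
  exact: (ae_eq_comp (fun x : R => (`|x%:E| `^ r)%E) fg).
case: ifPn => // _; apply: eq_ess_sup.
by apply: filterS fg => x /(_ I) /= ->.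
Qed.

Let to_Lfun_subproof F : (F : T -> R) \in Lfun mu p.
Proof.
apply/andP; split; last by rewrite inE; exact: (@Lebesgue_finite _ _ _ _ _ _ F).
rewrite inE.
exact: (@measurable_funPT _ _ _ _ (repr (LebesgueSpace.sort F))).
Qed.

Definition to_Lfun F : LfunType mu p1 := Lfun_Sub p1 (to_Lfun_subproof F).

Let mfun_of_Lfun f : {mfun T >-> measurableTypeR R} :=
  HB.pack_for {mfun T >-> measurableTypeR R} (f : T -> R)
    (@isMeasurableFun.Build _ _ T (measurableTypeR R) (f : T -> R)
       (@measurable_funPT _ _ _ _ f)).

Let eqclass f : {mfun_ mu, T >-> measurableTypeR R} :=
  (\pi_({mfun_ mu, T >-> measurableTypeR R}) (mfun_of_Lfun f))%qT.

Let eqclassE f : (eqclass f : T -> R) = f %[ae mu].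
Proof.
have : (repr (eqclass f) == mfun_of_Lfun f
          %[mod {mfun_ mu, T >-> measurableTypeR R}])%qT by rewrite reprK.
by rewrite eqmodE => /asboolP.
Qed.

Let eqclass_finite f : finite_norm mu p (eqclass f).
Proof.
rewrite /finite_norm (@Lnorm_ae_eq (eqclass f) f) //.
- exact: (@Lfunction_finite _ _ _ _ _ _ f).
- exact: (@measurable_funPT _ _ _ _ (repr (eqclass f))).
Qed.

Definition Lclass f : LspaceType mu p1 :=
  LebesgueSpace.Pack (LebesgueSpace.Class
    (@isFinLebesgue.Build _ _ _ mu p p1 (eqclass f) (eqclass_finite f))).

Lemma LclassE f : (Lclass f : T -> R) = f %[ae mu].
Proof. exact: eqclassE. Qed.

Lemma Lspace_ae_eq F G : (F : T -> R) = G %[ae mu] -> F = G.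
Proof.
case: F G => [F [[cF]]] [G [[cG]]] /= FG.
have FGE : F = G.
  rewrite -[F]reprK -[G]reprK; apply/eqP; rewrite eqmodE; exact/asboolP.
by case: _ / FGE in cG FG *; rewrite (Prop_irrelevance cF cG).
Qed.

HB.instance Definition _ := gen_eqMixin (LspaceType mu p1).
HB.instance Definition _ := gen_choiceMixin (LspaceType mu p1).

Definition Lspace_zero : LspaceType mu p1 := Lclass 0.
Definition Lspace_opp F := Lclass (- to_Lfun F).
Definition Lspace_add F G := Lclass (to_Lfun F + to_Lfun G).
Definition Lspace_scale (a : R) F := Lclass (a *: to_Lfun F).
Definition Lspace_norm F : R := fine 'N[mu]_p[EFin \o F]%E.

Let oppE F : (Lspace_opp F : T -> R) = (fun x => - F x) %[ae mu].
Proof. exact: LclassE. Qed.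

Let addE F G : (Lspace_add F G : T -> R) = (fun x => F x + G x) %[ae mu].
Proof. exact: LclassE. Qed.

Let scaleE a F : (Lspace_scale a F : T -> R) = (fun x => a * F x) %[ae mu].
Proof. exact: LclassE. Qed.

Let zeroE : (Lspace_zero : T -> R) = (fun=> 0) %[ae mu].
Proof. exact: LclassE. Qed.

Let addA : associative Lspace_add.
Proof.
move=> F G H; apply: Lspace_ae_eq.
apply: filterS (filterI (addE F (Lspace_add G H)) (filterI (addE G H)
  (filterI (addE (Lspace_add F G) H) (addE F G)))).
move=> x [/(_ I) + [/(_ I) + [/(_ I) + /(_ I) +]]] _.
by move=> -> -> -> ->; rewrite addrA.
Qed.

Let addC : commutative Lspace_add.
Proof. by move=> F G; rewrite /Lspace_add addrC. Qed.

Let add0 : left_id Lspace_zero Lspace_add.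
Proof.
move=> F; apply: Lspace_ae_eq.
apply: filterS (filterI (addE Lspace_zero F) zeroE).
by move=> x [/(_ I) + /(_ I) +] _; move=> -> ->; rewrite add0r.
Qed.

Let addN : left_inverse Lspace_zero Lspace_opp Lspace_add.
Proof.
move=> F; apply: Lspace_ae_eq.
apply: filterS (filterI (addE (Lspace_opp F) F) (filterI (oppE F) zeroE)).
by move=> x [/(_ I) + [/(_ I) + /(_ I) +]] _; move=> -> -> ->; rewrite addNr.
Qed.

HB.instance Definition _ :=
  GRing.isZmodule.Build (LspaceType mu p1) addA addC add0 addN.

Let scaleA a b F : Lspace_scale a (Lspace_scale b F) = Lspace_scale (a * b) F.
Proof.
apply: Lspace_ae_eq.
apply: filterS (filterI (scaleE a (Lspace_scale b F))
  (filterI (scaleE b F) (scaleE (a * b) F))).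
by move=> x [/(_ I) + [/(_ I) + /(_ I) +]] _; move=> -> -> ->; rewrite mulrA.
Qed.

Let scale1 : left_id 1 Lspace_scale.
Proof.
move=> F; apply: Lspace_ae_eq; apply: filterS (scaleE 1 F).
by move=> x /(_ I) -> _; rewrite mul1r.
Qed.

Let scaleDr : right_distributive Lspace_scale +%R.
Proof.
move=> a F G; apply: Lspace_ae_eq.
apply: filterS (filterI (scaleE a (F + G)) (filterI (addE F G)
  (filterI (addE (Lspace_scale a F) (Lspace_scale a G))
    (filterI (scaleE a F) (scaleE a G))))).
move=> x [/(_ I) + [/(_ I) + [/(_ I) + [/(_ I) + /(_ I) +]]]] _.
by move=> -> -> -> -> ->; rewrite mulrDr.
Qed.

Let scaleDl F : {morph Lspace_scale^~ F : a b / a + b}.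
Proof.
move=> a b; apply: Lspace_ae_eq.
apply: filterS (filterI (scaleE (a + b) F)
  (filterI (addE (Lspace_scale a F) (Lspace_scale b F))
    (filterI (scaleE a F) (scaleE b F)))).
move=> x [/(_ I) + [/(_ I) + [/(_ I) + /(_ I) +]]] _.
by move=> -> -> -> ->; rewrite mulrDl.
Qed.

HB.instance Definition _ :=
  GRing.Zmodule_isLmodule.Build R (LspaceType mu p1)
    scaleA scale1 scaleDr scaleDl.

Let normE F : Lspace_norm F = fine 'N[mu]_p[EFin \o to_Lfun F]%E.
Proof. by []. Qed.

Let norm_class f : Lspace_norm (Lclass f) = fine 'N[mu]_p[EFin \o f]%E.
Proof.
congr fine; apply: Lnorm_ae_eq => //; last exact: LclassE.
exact: (@measurable_funPT _ _ _ _ (to_Lfun (Lclass f))).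
Qed.

Let norm_add F G : Lspace_norm (F + G) <= Lspace_norm F + Lspace_norm G.
Proof. by rewrite norm_class !normE; exact: ler_LnormD. Qed.

Let norm_scale a F : Lspace_norm (a *: F) = `|a| * Lspace_norm F.
Proof.
rewrite norm_class !normE.
by apply: EFin_inj; rewrite EFinM !finite_norm_fine; exact: LnormZ.
Qed.

Let norm_eq0 F : Lspace_norm F = 0 -> F = 0.
Proof.
rewrite normE => /fine_Lnormr_eq0 F0; apply: Lspace_ae_eq.
apply: filterS (filterI F0 zeroE) => x [/(_ I) Fx /(_ I) zx] _.
exact: etrans Fx (esym zx).
Qed.

HB.instance Definition _ :=
  Lmodule_isNormed.Build R (LspaceType mu p1) norm_add norm_scale norm_eq0.

End Lspace_normed.

(** The class of a sequence for the counting measure is a singleton, so these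
are the square-summable real sequences with their Euclidean norm. *)
Definition ell2 (R : realType) : normedModType R :=
  LspaceType2 (@counting nat R).

Section subspace_normed.
Context (R : realType) (X : normedModType R) (E : submodClosed X).

Definition linear_subspace := {x : X | x \in E}.

HB.instance Definition _ := SubChoice.on linear_subspace.
HB.instance Definition _ := [SubChoice_isSubLmodule of linear_subspace by <:].

Let norm_sub (x : linear_subspace) : R := `|val x|.

Let norm_add x y : norm_sub (x + y) <= norm_sub x + norm_sub y.
Proof. exact: ler_normD. Qed.

Let norm_scale a x : norm_sub (a *: x) = `|a| * norm_sub x.
Proof. exact: normrZ. Qed.

Let norm_eq0 x : norm_sub x = 0 -> x = 0.
Proof. by move=> /normr0_eq0 x0; exact: val_inj. Qed.

HB.instance Definition _ :=
  Lmodule_isNormed.Build R linear_subspace norm_add norm_scale norm_eq0.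

End subspace_normed.

Section operators.
Context (R : realType).

Definition dual_ball (Z : normedModType R) : set {scalar Z} :=
  [set phi | forall z, `|phi z| <= `|z|].
Arguments dual_ball : clear implicits.

(** The supremum is taken over a set of reals that contains [0] and is bounded by
[\sum_(i < n) `|x i|], so [sup] is a genuine supremum. *)
Definition one_summing (Z Y : normedModType R) (T : {linear Z -> Y}) :=
  continuous T /\
  exists C : R, forall (n : nat) (x : 'I_n -> Z),
    \sum_(i < n) `|T (x i)| <=
    C * sup [set \sum_(i < n) `|phi (x i)| | phi in dual_ball Z].

Definition factors_through_L1 (Z Y : normedModType R) (T : {linear Z -> Y}) :=
  exists (d : measure_display) (Omega : measurableType d)
    (nu : {measure set Omega -> \bar R})
    (A : {linear Z -> LspaceType1 nu}) (B : {linear LspaceType1 nu -> Y}),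
    [/\ continuous A, continuous B & forall z, T z = B (A z)].

Definition GL2 (Z : normedModType R) :=
  forall T : {linear Z -> ell2 R}, one_summing T -> factors_through_L1 T.

(** The Rademacher average is written as the mean over all choices of signs
[(-1) ^+ e i], [e] ranging over the [2 ^ n] boolean functions on ['I_n]. *)
Definition cotype (q : R) (Z : normedModType R) :=
  exists C : R, forall (n : nat) (x : 'I_n -> Z),
    (\sum_(i < n) `|x i| `^ q) `^ q^-1 <=
    C * Num.sqrt ((2 ^+ n)^-1 *
          \sum_(e : {ffun 'I_n -> bool})
            `|\sum_(i < n) (-1) ^+ e i *: x i| ^+ 2).

Definition finite_cotype (Z : normedModType R) :=
  exists2 q : R, 2 <= q & cotype q Z.

End operators.

(* Main.v *)
(** If [E] has GL2 then [T = B A] with [A : E -> L_1] and [B : L_1 -> l_2]. By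
Khintchine's inequality applied to the values of simple functions (little
Grothendieck), [|\sum_k <T s_k, e_k>|] is at most a constant times the
Rademacher average of [s_1, .., s_N] in [E], which is also its average in [X].
When [s_k = \sum_i y_i(k) x_i] with [y_i] in the unit ball of [l_2], the latter
is the average norm of [\sum_i xi_i x_i] for subgaussian [xi_i]; since [X] has
finite cotype, Pisier's domination theorem for (q, 1)-summing operators on
[l_oo^n] and a layer-by-layer truncation of the [xi_i] bound it by a constant
times the weak l_1-norm of [(x_i)]. Hence the functional induced by [T] on the
finite sequences of [E] is dominated by the tensor norm on [l_2 (x) X] dual to
the 1-summing norm, and Hahn-Banach yields the extension. Conversely, GL2 of [X]
factors the extension, and one restricts the factorization to [E]. *)

From HB Require Import structures.
Require Import Defs.
From mathcomp Require Import all_boot all_order all_algebra.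
From mathcomp Require Import all_classical all_reals all_analysis.
From mathcomp Require Import measurable_realfun ring lra.
Import Order.TTheory GRing.Theory Num.Theory.
Import numFieldNormedType.Exports HBSimple.
Local Open Scope classical_set_scope.
Local Open Scope ring_scope.

Set Implicit Arguments.
Unset Strict Implicit.
Unset Printing Implicit Defensive.

(** * The Hahn-Banach theorem *)

Section hahn_banach.
Context {R : realType} {V : lmodType R}.
Implicit Types p g : V -> R.

Definition sublinear p :=
  (forall x y, p (x + y) <= p x + p y) /\
  (forall a x, 0 <= a -> p (a *: x) = a * p x).

(** The reverse inequality for [a] is the given one for [a^-1], applied to [a *: x]. *)
Lemma sublinearP p : (forall x y, p (x + y) <= p x + p y) -> p 0 = 0 ->
  (forall a x, 0 < a -> p (a *: x) <= a * p x) -> sublinear p.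
Proof.
move=> pD p0 pZ; split=> // a x; rewrite le_eqVlt => /predU1P[<-|a0].
  by rewrite scale0r p0 mul0r.
apply/eqP; rewrite eq_le pZ//= -ler_pdivlMl//.
have ai : 0 < a^-1 by rewrite invr_gt0.
by have := pZ _ (a *: x) ai; rewrite scalerA mulVf ?gt_eqF// scale1r.
Qed.

Lemma sublinear0 p : sublinear p -> p 0 = 0.
Proof. by case=> _ pZ; rewrite -(scale0r 0) pZ// mul0r. Qed.

Lemma sublinear_opp p x : sublinear p -> - p (- x) <= p x.
Proof. by move=> slp; have := slp.1 x (- x); rewrite subrr sublinear0//; lra. Qed.

Section shift.
Variables (p : V -> R) (K : set V) (h : V -> R).
Hypotheses (slp : sublinear p) (K0 : K 0) (h0 : h 0 = 0).
Hypotheses (KD : forall x y, K x -> K y -> K (x + y) /\ h (x + y) = h x + h y).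
Hypotheses (KZ : forall a x, 0 < a -> K x ->
  K (a *: x) /\ h (a *: x) = a * h x).
Hypothesis hp : forall x, K x -> h x <= p x.

Let S x := [set p (x + y) - h y | y in K].
(** It is used twice: with [K] a ray and [h = p], to show that minimal functionals are additive, and
    with [K] a subspace and [h] the functional to be extended. *)
Definition shift x := inf (S x).

Let Slb x : lbound (S x) (- p (- x)).
Proof.
move=> _ [y Ky <-]; have := hp Ky; have := slp.1 (x + y) (- x).
by rewrite addrAC subrr add0r; lra.
Qed.

Let Sn0 x : S x !=set0.
Proof. by exists (p (x + 0) - h 0); exists 0. Qed.

Lemma shift_le x y : K y -> shift x <= p (x + y) - h y.
Proof. by move=> Ky; apply: ge_inf; [exists (- p (- x))|exists y]. Qed.

Let shift_ge x c : (forall y, K y -> c <= p (x + y) - h y) -> c <= shift x.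
Proof. by move=> H; apply: lb_le_inf => // _ [y Ky <-]; exact: H. Qed.

Lemma sublinear_shift : sublinear shift.
Proof.
apply: sublinearP => [x y||a x a0].
- rewrite -lerBlDr; apply: shift_ge => u Ku.
  rewrite lerBlDr -lerBlDl; apply: shift_ge => v Kv.
  have [Kuv huv] := KD Ku Kv; rewrite lerBlDl.
  apply: le_trans (shift_le _ Kuv) _; rewrite huv addrACA.
  by have := slp.1 (x + u) (y + v); lra.
- apply/eqP; rewrite eq_le; apply/andP; split.
    apply: le_trans (shift_le _ K0) _.
    by rewrite addr0 h0 (sublinear0 slp) subr0.
  by apply: shift_ge => y Ky; rewrite add0r subr_ge0; exact: hp.
- rewrite -ler_pdivrMl//; apply: shift_ge => y Ky.
  have [Kay hay] := KZ a0 Ky.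
  rewrite ler_pdivrMl//; apply: le_trans (shift_le _ Kay) _.
  by rewrite hay -scalerDr (slp.2 _ _ (ltW a0)) mulrBr.
Qed.

End shift.

(** Zorn's lemma: the pointwise infimum of a chain of sublinear functionals below [p] is again one,
    and [- p (- x)] keeps it finite. *)
Lemma minimal_sublinear p : sublinear p -> exists g,
  [/\ sublinear g, forall x, g x <= p x &
    forall g', sublinear g' -> (forall x, g' x <= g x) -> g' = g].
Proof.
move=> slp.
pose T := {g : V -> R | sublinear g /\ forall x, g x <= p x}.
pose t0 : T := exist _ p (conj slp (fun x => lexx _)).
(* The order is reversed, so that maximal elements are minimal functionals. *)
pose le (s t : T) := `[< forall x, sval t x <= sval s x >].
have [|||[g [slg gp]] gmin] := @ZL_preorder T t0 le.
- by move=> t; apply/asboolP => x.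
- by move=> r s t /asboolP rs /asboolP st; apply/asboolP => x; exact: le_trans (st x) (rs x).
- move=> A totA; have [[s0 As0]|A0] := pselect (A !=set0); last first.
    by exists t0 => s As; case: A0; exists s.
  pose S x := [set sval s x | s in A].
  have Slb x : lbound (S x) (- p (- x)).
    move=> _ [[s [sls sp]] As <-] /=.
    by apply: le_trans (sublinear_opp x sls); rewrite lerN2.
  have Sn0 x : S x !=set0 by exists (sval s0 x); exists s0.
  have Sle s x : A s -> inf (S x) <= sval s x.
    by move=> As; apply: ge_inf; [exists (- p (- x))|exists s].
  have Sge x c : (forall s, A s -> c <= sval s x) -> c <= inf (S x).
    by move=> H; apply: lb_le_inf => // _ [s As <-]; exact: H.
  have slS : sublinear (fun x => inf (S x)).
    apply: sublinearP => [x y||a x a0].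
    + rewrite -lerBlDr; apply: (Sge) => s As; rewrite lerBlDr -lerBlDl.
      apply: (Sge) => t At; rewrite lerBlDl.
      (* On a chain, both competitors can be replaced by the smaller one. *)
      have /orP[|] : le s t || le t s by apply/orP; exact: totA.
        move=> /asboolP st; apply: le_trans (Sle t _ At) _.
        by apply: le_trans (proj1 (proj1 (proj2_sig t)) _ _) _; rewrite lerD2r.
      move=> /asboolP ts; apply: le_trans (Sle s _ As) _.
      by apply: le_trans (proj1 (proj1 (proj2_sig s)) _ _) _; rewrite lerD2l.
    + have s00 (s : T) : sval s 0 = 0.
        exact: sublinear0 (proj1 (proj2_sig s)).
      apply/eqP; rewrite eq_le; apply/andP; split.
        by rewrite -(s00 s0); exact: Sle.
      by apply: (Sge) => s As; rewrite s00.
    + rewrite -ler_pdivrMl//; apply: (Sge) => s As; rewrite ler_pdivrMl//.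
      apply: le_trans (Sle s _ As) _.
      by rewrite (proj2 (proj1 (proj2_sig s)) _ _ (ltW a0)).
  have Sp x : inf (S x) <= p x.
    by apply: le_trans (Sle s0 x As0) _; exact: (proj2 (proj2_sig s0)).
  exists (exist _ (fun x => inf (S x)) (conj slS Sp)) => s As.
  by apply/asboolP => x /=; exact: Sle.
- exists g; split=> // g' slg' g'g.
  have g'p x : g' x <= p x by exact: le_trans (gp x).
  have /asboolP /= := gmin (exist _ g' (conj slg' g'p)) (asboolT g'g).
  by move=> gg'; apply/funext => x; apply/eqP; rewrite eq_le g'g gg'.
Qed.

(* A minimal sublinear functional coincides with its shift along any ray, which
   forces additivity. *)
Lemma sublinear_above_scalar p : sublinear p ->
  exists g : {scalar V}, forall x, g x <= p x.
Proof.
move=> /minimal_sublinear[g [slg gp gmin]].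
have gD x y : g (x + y) = g x + g y.
  pose K := [set t *: y | t in [set t : R | 0 <= t]].
  have hE : shift g K g = g.
    apply: gmin.
      apply: sublinear_shift => //.
      - by exists 0 => //=; rewrite scale0r.
      - exact: sublinear0.
      - move=> _ _ [s /= s0 <-] [t /= t0 <-]; rewrite -scalerDl; split.
          by exists (s + t) => //=; exact: addr_ge0.
        by rewrite !slg.2// ?addr_ge0// mulrDl.
      - move=> a _ a0 [s /= s0 <-]; rewrite scalerA; split.
          by exists (a * s) => //=; rewrite mulr_ge0// ltW.
        by rewrite !slg.2// ?mulr_ge0// ?ltW// mulrA.
    move=> z; apply: le_trans (@shift_le g K g _ _ z 0 _) _ => //.
    - by exists 0 => //=; rewrite scale0r.
    - by rewrite addr0 (sublinear0 slg) subr0.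
  apply/eqP; rewrite eq_le slg.1/= -lerBrDr -{1}hE.
  by apply: shift_le => //; exists 1 => //=; rewrite scale1r.
have gN x : g (- x) = - g x.
  by have := gD x (- x); rewrite subrr (sublinear0 slg); lra.
have gZ a x : g (a *: x) = a * g x.
  have [a0|a0] := leP 0 a; first exact: slg.2.
  have Na0 : 0 <= - a by rewrite oppr_ge0 ltW.
  by apply: oppr_inj; rewrite -gN -scaleNr slg.2// mulNr.
have glin : GRing.scalable_for *%R (g : V -> R^o) by move=> a x; exact: gZ.
have gadd : zmod_morphism (g : V -> R^o) by move=> x y; rewrite gD gN.
pose G : {scalar V} := HB.pack_for {scalar V} (g : V -> R^o)
  (GRing.isZmodMorphism.Build _ _ _ gadd)
  (GRing.isScalable.Build _ _ _ _ _ glin).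
by exists G.
Qed.

(** A linear [g] below the shift of [p] satisfies [g x <= p (x + y) - f y] for [y] in [F]: [y = 0]
    gives domination by [p], [y = - x] gives [g <= f] on [F], and linearity turns the latter into
    equality. *)
Theorem hahn_banach p (F : set V) (f : V -> R) : sublinear p ->
  F 0 -> (forall x y, F x -> F y -> F (x + y) /\ f (x + y) = f x + f y) ->
  (forall a x, F x -> F (a *: x) /\ f (a *: x) = a * f x) ->
  (forall x, F x -> f x <= p x) ->
  exists g : {scalar V}, (forall x, g x <= p x) /\ (forall x, F x -> g x = f x).
Proof.
move=> slp F0 FD FZ fp.
have f0 : f 0 = 0 by rewrite -(scale0r 0) (FZ 0 0 F0).2 mul0r.
have FZ' a x : 0 < a -> F x -> F (a *: x) /\ f (a *: x) = a * f x.
  by move=> _; exact: FZ.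
have sls := sublinear_shift slp F0 f0 FD FZ' fp.
have [g gs] := sublinear_above_scalar sls.
have gsh x y : F y -> g x <= p (x + y) - f y.
  by move=> Fy; apply: le_trans (gs x) _; apply: shift_le.
have gf x : F x -> g x <= f x.
  move=> Fx; have [FN fN] := FZ (-1) _ Fx.
  have := gsh x _ FN; rewrite fN scaleN1r subrr (sublinear0 slp).
  by lra.
exists g; split=> [x|x Fx].
  by have := gsh x _ F0; rewrite addr0 f0 subr0.
apply/eqP; rewrite eq_le gf//=.
have [FN fN] := FZ (-1) _ Fx; have := gf _ FN.
by rewrite fN scaleN1r linearN /=; lra.
Qed.

End hahn_banach.

(** Extend from the line through [x] the functional sending [x] to its norm. The case [x = 0] is
    included, so the dual ball is nonempty. *)
Lemma norming_functional (R : realType) (X : normedModType R) (x : X) :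
  exists2 phi : {scalar X}, dual_ball phi & phi x = `|x|.
Proof.
have sln : sublinear (fun y : X => `|y|).
  split=> [u v|a u a0]; first exact: ler_normD.
  by rewrite normrZ ger0_norm.
have [x0|xN0] := eqVneq x 0.
  have [g gn] := sublinear_above_scalar sln.
  exists g; last by rewrite x0 linear0 normr0.
  move=> z; rewrite ler_norml gn andbT lerNl -linearN.
  by rewrite (le_trans (gn _))// normrN.
have nx : `|x| != 0 by rewrite normr_eq0.
have inj a b : a *: x = b *: x -> a = b.
  move=> /eqP; rewrite -subr_eq0 -scalerBl scaler_eq0 (negbTE xN0) orbF.
  by rewrite subr_eq0 => /eqP.
pose F := range (fun a : R => a *: x).
(* [xget] reads off the coefficient on the line, unique by [inj]; its default [0] is taken only
   outside [F]. *)
pose f y := xget 0 [set a | y = a *: x] * `|x|.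
have fE a : f (a *: x) = a * `|x|.
  by rewrite /f; case: xgetP => [b _ /= /inj ->//|/(_ a)[]].
have [||||g [gn gf]] := @hahn_banach _ _ _ F f sln.
- by exists 0 => //; rewrite scale0r.
- move=> _ _ [a _ <-] [b _ <-]; rewrite -scalerDl !fE mulrDl; split=> //.
  by exists (a + b).
- move=> a _ [b _ <-]; rewrite scalerA !fE mulrA; split=> //.
  by exists (a * b).
- by move=> _ [a _ <-]; rewrite fE normrZ ler_wpM2r// ler_norm.
- exists g.
    move=> z; rewrite ler_norml gn andbT lerNl -linearN.
    by rewrite (le_trans (gn _))// normrN.
  by rewrite -{1}(scale1r x) gf ?fE ?mul1r//; exists 1.
Qed.

(** * Rademacher averages *)

Section rademacher.
Context {R : realType}.

(** The expectation over independent uniform signs, in the form in which it occurs in [cotype]. *)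
Definition rad_mean n (f : {ffun 'I_n -> bool} -> R) : R :=
  (2 ^+ n)^-1 * \sum_(e : {ffun 'I_n -> bool}) f e.

Lemma rad_meanD n (f g : {ffun 'I_n -> bool} -> R) :
  rad_mean (fun e => f e + g e) = rad_mean f + rad_mean g.
Proof. by rewrite /rad_mean big_split mulrDr. Qed.

Lemma rad_meanZ n c (f : {ffun 'I_n -> bool} -> R) :
  rad_mean (fun e => c * f e) = c * rad_mean f.
Proof. by rewrite /rad_mean -mulr_sumr mulrCA. Qed.

Lemma rad_mean_sum n (I : Type) (r : seq I) (P : pred I)
    (f : I -> {ffun 'I_n -> bool} -> R) :
  rad_mean (fun e => \sum_(i <- r | P i) f i e) =
  \sum_(i <- r | P i) rad_mean (f i).
Proof. by rewrite /rad_mean exchange_big mulr_sumr. Qed.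

Lemma rad_mean_cst n (c : R) : rad_mean (fun _ : {ffun 'I_n -> bool} => c) = c.
Proof.
rewrite /rad_mean sumr_const card_ffun card_bool card_ord.
by rewrite -[c *+ _]mulr_natl natrX mulKf// expf_neq0// pnatr_eq0.
Qed.

Lemma le_rad_mean n (f g : {ffun 'I_n -> bool} -> R) :
  (forall e, f e <= g e) -> rad_mean f <= rad_mean g.
Proof. by move=> fg; rewrite ler_wpM2l ?invr_ge0 ?exprn_ge0// ler_sum. Qed.

Lemma rad_mean_ge0 n (f : {ffun 'I_n -> bool} -> R) :
  (forall e, 0 <= f e) -> 0 <= rad_mean f.
Proof. by move=> f0; rewrite mulr_ge0 ?invr_ge0 ?exprn_ge0// sumr_ge0. Qed.

(** Independence of the signs: expand the product of the two-term sums. *)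
Lemma rad_mean_prod n (F : 'I_n -> bool -> R) :
  rad_mean (fun e => \prod_k F k (e k)) =
  \prod_k ((F k true + F k false) / 2).
Proof.
rewrite big_split/= prodr_const card_ord exprVn mulrC; congr (_ * _).
under [RHS]eq_bigr do rewrite -big_bool.
by rewrite bigA_distr_bigA.
Qed.

Definition rad_sum n (a : 'I_n -> R) (e : {ffun 'I_n -> bool}) : R :=
  \sum_(k < n) (-1) ^+ e k * a k.

(** For [a >= 0] and [b = a / 2], [cosh a = 1 + (expR b - expR (- b)) ^+ 2 / 2], where the
    difference is at most [3 * b]; conclude by [1 + x <= expR x]. *)
Lemma cosh_le (a : R) : `|a| <= 1 -> (expR a + expR (- a)) / 2 <= expR (2 * a ^+ 2).
Proof.
wlog a0 : a / 0 <= a => [H a1|].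
  have [a0|/ltW a0] := leP 0 a; first exact: H.
  by have := H (- a); rewrite oppr_ge0 normrN opprK sqrrN addrC; exact.
rewrite ger0_norm// => a1; set b := a / 2.
have ab : a = b *+ 2 by rewrite /b -mulr_natr divfK.
have b0 : 0 <= b by rewrite divr_ge0.
have b1 : b <= 1 / 2 by rewrite /b; lra.
have uv : expR b * expR (- b) = 1 by rewrite expRxMexpNx_1.
have v1 := expR_ge1Dx (- b); have u1 := expR_ge1Dx b.
have v0 := expR_gt0 (- b); have u0 := expR_gt0 b.
have -> : expR a = expR b ^+ 2 by rewrite ab -mulr_natl expRM_natl.
have -> : expR (- a) = expR (- b) ^+ 2 by rewrite ab -mulNrn -mulr_natl expRM_natl.
apply: le_trans (expR_ge1Dx _); rewrite ab.
move: (expR b) (expR (- b)) uv v1 u1 v0 u0 => u v uv v1 u1 v0 u0.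
have u2 : u <= 1 + 2 * b by nra.
have : (u - v) ^+ 2 <= (3 * b) ^+ 2 by rewrite lerXn2r ?nnegrE; nra.
nra.
Qed.

(** Sums of signs are subgaussian: by independence the mean of [expR (rad_sum a e)] is a product of
    hyperbolic cosines, and [expR |t| <= expR t + expR (- t)] accounts for the factor 2. *)
Lemma rad_exp n (a : 'I_n -> R) : \sum_k a k ^+ 2 <= 1 ->
  rad_mean (fun e => expR `|rad_sum a e|) <= 2 * expR 2.
Proof.
have exp_le (b : 'I_n -> R) : \sum_k b k ^+ 2 <= 1 ->
    rad_mean (fun e => expR (rad_sum b e)) <= expR 2.
  move=> b1.
  have -> : rad_mean (fun e => expR (rad_sum b e)) =
      rad_mean (fun e => \prod_k expR ((-1) ^+ e k * b k)).
    by congr rad_mean; apply/funext => e; rewrite /rad_sum expR_sum.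
  rewrite (rad_mean_prod (fun k (c : bool) => expR ((-1) ^+ c * b k))).
  apply: (@le_trans _ _ (\prod_k expR (2 * b k ^+ 2))).
    apply: ler_prod => k _; rewrite mulN1r mul1r divr_ge0 ?addr_ge0 ?expR_ge0//=.
    rewrite addrC; apply: cosh_le.
    rewrite -(@expr_le1 _ 2)// real_normK ?num_real//.
    apply: le_trans b1; rewrite (bigD1 k)//= lerDl sumr_ge0// => i _.
    exact: sqr_ge0.
  by rewrite -expR_sum ler_expR -mulr_sumr; lra.
move=> a1; rewrite mulr_natl mulr2n.
apply: le_trans (lerD (exp_le _ a1) (exp_le (fun k => - a k) _)); last first.
  by under eq_bigr do rewrite sqrrN.
rewrite -rad_meanD; apply: le_rad_mean => e.
have -> : rad_sum (fun k => - a k) e = - rad_sum a e.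
  by rewrite /rad_sum -sumrN; apply: eq_bigr => k _; rewrite mulrN.
have [_|_] := ger0P (rad_sum a e); first by rewrite lerDl expR_ge0.
by rewrite lerDr expR_ge0.
Qed.

(** Raise [t / k <= expR (t / k)] to the power [k]. *)
Lemma exprn_le_expR k (t : R) : 0 <= t -> t ^+ k <= k%:R ^+ k * expR t.
Proof.
case: k => [|k] t0; first by rewrite !expr0 mul1r -expR0 ler_expR.
have k0 : k.+1%:R != 0 :> R by rewrite pnatr_eq0.
have -> : expR t = expR (t / k.+1%:R) ^+ k.+1.
  by rewrite -expRM_natl mulrC divfK.
rewrite -exprMn lerXn2r ?nnegrE ?mulr_ge0 ?expR_ge0//.
rewrite -ler_pdivrMl ?ltr0n// mulrC.
by apply: le_trans (expR_ge1Dx _); rewrite lerDr.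
Qed.

Lemma rad_mean_sqr n (a : 'I_n -> R) :
  rad_mean (fun e => rad_sum a e ^+ 2) = \sum_k a k ^+ 2.
Proof.
have -> : rad_mean (fun e => rad_sum a e ^+ 2) =
  rad_mean (fun e => \sum_j \sum_k a j * a k * ((-1) ^+ e j * (-1) ^+ e k)).
  congr rad_mean; apply/funext => e; rewrite expr2 /rad_sum mulr_suml.
  apply: eq_bigr => j _; rewrite mulr_sumr; apply: eq_bigr => k _; ring.
rewrite rad_mean_sum; apply: eq_bigr => j _; rewrite rad_mean_sum.
rewrite (bigD1 j)//= big1 ?addr0 => [|k kj].
  rewrite rad_meanZ -expr2.
  under [X in rad_mean X]eq_fun do rewrite -expr2 sqrr_sign.
  by rewrite rad_mean_cst mulr1.
rewrite rad_meanZ.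
(* The product of two signs becomes a product over all indices, so that independence applies; the
   factor at [j] averages to zero. *)
pose F (i : 'I_n) (c : bool) : R :=
  (if i == j then (-1) ^+ c else 1) * (if i == k then (-1) ^+ c else 1).
have -> : rad_mean (fun e : {ffun 'I_n -> bool} => (-1) ^+ e j * (-1) ^+ e k) =
    rad_mean (fun e : {ffun 'I_n -> bool} => \prod_i F i (e i)).
  congr rad_mean; apply/funext => e; rewrite /F big_split/=.
  by rewrite -!big_mkcond !big_pred1_eq.
rewrite rad_mean_prod (bigD1 j)//= /F eqxx eq_sym (negbTE kj).
by rewrite !mulr1 expr0 expr1 addNr mul0r mul0r mulr0.
Qed.

(** For a normalised sum the second moment is 1 and the fourth is bounded, which keeps the first
    moment away from zero. The constant does not depend on [n]. *)
Lemma khintchine : exists2 K : R, 0 <= K & forall n (a : 'I_n -> R),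
  Num.sqrt (\sum_k a k ^+ 2) <= K * rad_mean (fun e => `|rad_sum a e|).
Proof.
(* [M] bounds the fourth moment through [t ^+ 4 <= 4 ^+ 4 * expR t]; with [L ^+ 2 = 2 * M] the
   fourth-moment term below contributes at most 1/2. *)
pose M : R := 4 ^+ 4 * (2 * expR 2); pose L := Num.sqrt (2 * M).
have M0 : 0 < M by rewrite !mulr_gt0 ?exprn_gt0 ?expR_gt0.
have L0 : 0 < L by rewrite sqrtr_gt0 mulr_gt0.
have L2 : L ^+ 2 = 2 * M by rewrite sqr_sqrtr// ltW// mulr_gt0.
exists (2 * L) => [|n a]; first by rewrite mulr_ge0// ltW.
set s := Num.sqrt _.
have S0 : 0 <= \sum_k a k ^+ 2 by apply: sumr_ge0 => k _; exact: sqr_ge0.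
have s2 : s ^+ 2 = \sum_k a k ^+ 2 by rewrite sqr_sqrtr.
have [s0|sN0] := eqVneq s 0.
  rewrite s0; apply: mulr_ge0; first by rewrite mulr_ge0// ltW.
  exact: rad_mean_ge0.
have s_gt0 : 0 < s by rewrite lt_neqAle eq_sym sN0 sqrtr_ge0.
pose b k := a k / s.
have b1 : \sum_k b k ^+ 2 = 1.
  under eq_bigr do rewrite expr_div_n.
  by rewrite -mulr_suml -s2 divff// expf_neq0.
have ab e : rad_sum a e = s * rad_sum b e.
  rewrite /rad_sum mulr_sumr; apply: eq_bigr => k _.
  by rewrite mulrCA /b [s * _]mulrC divfK.
have -> : rad_mean (fun e => `|rad_sum a e|) = s * rad_mean (fun e => `|rad_sum b e|).
  rewrite -rad_meanZ; congr rad_mean; apply/funext => e.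
  by rewrite ab normrM gtr0_norm.
rewrite mulrCA -{1}(mulr1 s) ler_pM2l//.
have E4 : rad_mean (fun e => `|rad_sum b e| ^+ 4) <= M.
  apply: le_trans (_ : rad_mean (fun e => 4 ^+ 4 * expR `|rad_sum b e|) <= _).
    by apply: le_rad_mean => e; exact: exprn_le_expR.
  rewrite rad_meanZ ler_wpM2l ?exprn_ge0//.
  by apply: rad_exp; rewrite b1.
(* Pointwise [t ^+ 2 <= L * t + t ^+ 4 / L ^+ 2], by comparing [t] with [L]. *)
have : rad_mean (fun e => rad_sum b e ^+ 2) <=
    rad_mean (fun e => L * `|rad_sum b e| + (L ^+ 2)^-1 * `|rad_sum b e| ^+ 4).
  apply: le_rad_mean => e; rewrite -real_normK ?num_real//.
  move: `|_| (normr_ge0 (rad_sum b e)) => t t0.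
  have Li : 0 < (L ^+ 2)^-1 by rewrite invr_gt0 exprn_gt0.
  have [tL|/ltW Lt] := leP t L.
    have : 0 <= (L ^+ 2)^-1 * t ^+ 4 by rewrite mulr_ge0 ?exprn_ge0// ltW.
    nra.
  apply: (@le_trans _ _ ((L ^+ 2)^-1 * t ^+ 4)); last by rewrite lerDr mulr_ge0// ltW.
  rewrite ler_pdivlMl ?exprn_gt0// -[in leRHS](_ : (2 + 2)%N = 4%N)// exprD.
  by rewrite ler_wpM2r ?exprn_ge0// lerXn2r ?nnegrE// ltW.
rewrite rad_mean_sqr b1 rad_meanD !rad_meanZ L2.
have : (2 * M)^-1 * rad_mean (fun e => `|rad_sum b e| ^+ 4) <= 1 / 2.
  by rewrite ler_pdivrMl ?mulr_gt0//; lra.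
lra.
Qed.

End rademacher.

(** * Finite cotype *)

Section finite_cotype.
Context {R : realType} {X : normedModType R}.

(** The condition on signed sums says that the weak l_1-norm is at most 1, so the identity of [X] is
    (Q+1, 1)-summing. A natural exponent permits plain powers. *)
Definition integral_cotype (Q : nat) (C : R) :=
  forall (m : nat) (z : 'I_m -> X),
    (forall e : {ffun 'I_m -> bool}, `|\sum_(j < m) (-1) ^+ e j *: z j| <= 1) ->
    \sum_(j < m) `|z j| ^+ Q.+1 <= C.

(** Signed sums in the unit ball bound the Rademacher average by 1, so each [|z j|] is at most [C];
    after division by [C], raising the exponent from [q] to [Q.+1] only decreases the terms. *)
Lemma finite_cotype_integral : finite_cotype X ->
  exists Q C, 0 <= C /\ integral_cotype Q C.
Proof.
move=> [q q2 [C0 HC]]; have q0 : 0 < q by lra.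
pose C := Num.max 1 C0.
have C1 : 1 <= C by rewrite le_max lexx.
have C_gt0 : 0 < C by lra.
pose Q := (Num.truncn q).
have qQ : q <= Q.+1%:R by rewrite ltW// truncnS_gt.
exists Q, (C ^+ Q.+1); split=> [|m z z1]; first by rewrite exprn_ge0// ltW.
have : (\sum_(j < m) `|z j| `^ q) `^ q^-1 <= C.
  apply: le_trans (HC _ _) _.
  have h1 : 0 <= Num.sqrt ((2 ^+ m)^-1 * \sum_(e : {ffun 'I_m -> bool})
      `|\sum_(i < m) (-1) ^+ e i *: z i| ^+ 2) by exact: sqrtr_ge0.
  apply: (@le_trans _ _ (C * Num.sqrt ((2 ^+ m)^-1 * \sum_(e : {ffun 'I_m -> bool})
      `|\sum_(i < m) (-1) ^+ e i *: z i| ^+ 2))).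
    by rewrite ler_wpM2r// le_max lexx orbT.
  rewrite -[leRHS]mulr1 ler_pM2l// -[leRHS]sqrtr1 ler_wsqrtr//.
  rewrite -[leRHS](rad_mean_cst m); apply: le_rad_mean => e.
  by rewrite expr_le1.
set S := \sum_(j < m) _ => SC.
have S0 : 0 <= S by apply: sumr_ge0 => j _; exact: powR_ge0.
have {}SC : S <= C `^ q.
  have := ge0_ler_powR (ltW q0) _ _ SC; rewrite !nnegrE powR_ge0 ltW//.
  by rewrite -powRrM mulVf ?gt_eqF// powRr1// => /(_ isT isT).
have zC j : `|z j| / C <= 1.
  rewrite ler_pdivrMr// mul1r leNgt; apply/negP => Cz.
  have := gt0_ltr_powR q0 _ _ Cz; rewrite !nnegrE (ltW C_gt0) normr_ge0.
  move=> /(_ isT isT); apply/negP; rewrite -leNgt; apply: le_trans SC.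
  by rewrite /S (bigD1 j)//= lerDl sumr_ge0// => i _; exact: powR_ge0.
apply: (@le_trans _ _ (\sum_(j < m) C ^+ Q.+1 * (`|z j| `^ q / C `^ q))).
  apply: ler_sum => j _.
  have -> : `|z j| ^+ Q.+1 = C ^+ Q.+1 * (`|z j| / C) ^+ Q.+1.
    by rewrite -exprMn mulrC divfK ?gt_eqF.
  rewrite ler_wpM2l ?exprn_ge0 ?(ltW C_gt0)//.
  have Ci : C `^ q * (C^-1) `^ q = 1.
    by rewrite -powRM ?invr_ge0 ?(ltW C_gt0)// mulfV ?gt_eqF// powR1.
  have -> : `|z j| `^ q / C `^ q = (`|z j| / C) `^ q.
    rewrite powRM ?invr_ge0 ?(ltW C_gt0)//; congr (_ * _).
    have CqN0 : C `^ q != 0 by rewrite gt_eqF// powR_gt0.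
    by apply: (mulfI CqN0); rewrite Ci mulfV.
  have := normr_ge0 (z j); rewrite le_eqVlt => /predU1P[<-|zj].
    by rewrite mul0r expr0n/= powR_ge0.
  rewrite -powR_mulrn ?divr_ge0 ?(ltW C_gt0)//; apply: ger_powR => //.
  by rewrite divr_gt0//=.
rewrite -mulr_sumr -mulr_suml -/S -[leRHS]mulr1 ler_pM2l ?exprn_gt0//.
by rewrite ler_pdivrMr ?powR_gt0// mul1r.
Qed.

End finite_cotype.

(** * Domination of operators on l_oo^n under a cotype condition *)

Section cotype_factorization.
Context {R : realType} {X : normedModType R}.

Definition weak_l1_le n (x : 'I_n -> X) (W : R) :=
  forall phi, dual_ball phi -> \sum_(i < n) `|phi (x i)| <= W.

(** Evaluate a norming functional of the sum. *)
Lemma norm_weak_l1 n (x : 'I_n -> X) W (a : 'I_n -> R) :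
  weak_l1_le x W -> (forall i, `|a i| <= 1) -> `|\sum_(i < n) a i *: x i| <= W.
Proof.
move=> xW a1; have [phi phi1 <-] := norming_functional (\sum_(i < n) a i *: x i).
apply: le_trans (xW _ phi1); apply: le_trans (ler_norm _) _.
rewrite linear_sum; apply: le_trans (ler_norm_sum _ _ _) _; apply: ler_sum => i _.
by rewrite linearZ normrM ler_piMl.
Qed.

(** Convexity: the power lies above its tangent at [s]. The induction step leaves a nonnegative
    multiple of [(t - s) ^+ 2]. *)
Lemma exprn_tangent_le k (s t : R) : 0 <= s -> 0 <= t ->
  s ^+ k.+1 + k.+1%:R * s ^+ k * (t - s) <= t ^+ k.+1.
Proof.
move=> s0 t0; elim: k => [|k IH]; first by rewrite expr0; lra.
have sk : 0 <= s ^+ k by exact: exprn_ge0.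
have k0 : 0 <= k.+1%:R :> R by [].
rewrite [t ^+ _]exprSr; apply: le_trans (ler_wpM2r t0 IH).
rewrite -subr_ge0 -[k.+2%:R]natr1 !exprSr.
have -> : (s ^+ k * s + k.+1%:R * s ^+ k * (t - s)) * t -
    (s ^+ k * s * s + (k.+1%:R + 1) * (s ^+ k * s) * (t - s)) =
    k.+1%:R * s ^+ k * (t - s) ^+ 2 by ring.
by rewrite mulr_ge0 ?sqr_ge0// mulr_ge0.
Qed.

(* Test an almost extremal family [f_j] for the (Q+1, 1)-summing norm of
   [u a = \sum_i a_i x_i] on [l_oo^n] against [g, (1 - |g|) f_j]. *)
Lemma cotype_domination Q C n (x : 'I_n -> X) (delta : R) :
  @integral_cotype R X Q C -> weak_l1_le x 1 -> 0 < delta ->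
  exists kappa : 'I_n -> R, [/\ forall i, 0 <= kappa i,
    \sum_i kappa i <= C + delta &
    forall g : 'I_n -> R, (forall i, `|g i| <= 1) ->
      `|\sum_i g i *: x i| ^+ Q.+1 <=
        delta + Q.+1%:R * \sum_i kappa i * `|g i|].
Proof.
move=> HC x1 d0; pose u (a : 'I_n -> R) := \sum_i a i *: x i.
have u0 : u (fun=> 0) = 0 by rewrite /u big1// => i _; rewrite scale0r.
pose adm m (f : 'I_m -> 'I_n -> R) := forall i, \sum_(j < m) `|f j i| <= 1.
pose val m (f : 'I_m -> 'I_n -> R) := \sum_(j < m) `|u (f j)| ^+ Q.+1.
(* Admissibility bounds every signed sum of the [f j] by 1 in l_oo^n, hence every signed sum of the
   [u (f j)] by 1 in [X]. *)
have valC m (f : 'I_m -> 'I_n -> R) : adm m f -> val m f <= C.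
  move=> admf; apply: HC => e.
  have -> : \sum_(j < m) (-1) ^+ e j *: u (f j) =
      u (fun i => \sum_(j < m) (-1) ^+ e j * f j i).
    under eq_bigr do rewrite scaler_sumr.
    rewrite exchange_big; apply: eq_bigr => i _; rewrite scaler_suml.
    by apply: eq_bigr => j _; rewrite scalerA.
  apply: norm_weak_l1 => // i; apply: le_trans (admf i).
  apply: le_trans (ler_norm_sum _ _ _) _; apply: ler_sum => j _.
  by rewrite normrM normrX normrN1 expr1n mul1r.
pose A := [set r | exists m (f : 'I_m -> 'I_n -> R), adm m f /\ r = val m f].
have Aub : has_ubound A by exists C => _ [m [f [af ->]]]; exact: valC.
have An0 : A !=set0.
  exists (val 0 (fun=> fun=> 0)), 0, (fun=> fun=> 0); split=> // i.
  by rewrite big_ord0.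
have leS m (f : 'I_m -> 'I_n -> R) : adm m f -> val m f <= sup A.
  by move=> af; apply: ub_le_sup => //; exists m, f.
(* The [n] summands [d] added to [lam] below stay under [delta]; the divisor is nonzero even if
   [n = 0]. *)
pose d := delta / n.+1%:R.
have dpos : 0 < d by rewrite divr_gt0.
have dd : d *+ n.+1 = delta by rewrite -mulr_natr divfK// pnatr_eq0.
have d_le : d <= delta by rewrite -dd mulrS lerDl mulrn_wge0// ltW.
have [_ [m [f [af ->]]] fS] := sup_adherent dpos (conj An0 Aub).
have [phi phiP] : {phi : 'I_m -> {scalar X} |
    forall j, dual_ball (phi j) /\ phi j (u (f j)) = `|u (f j)|}.
  have [phi phiP] := @choice _ _ (fun j (phi : {scalar X}) =>
    dual_ball phi /\ phi (u (f j)) = `|u (f j)|)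
    (fun j => let: ex_intro2 p h1 h2 := norming_functional (u (f j)) in
       ex_intro _ p (conj h1 h2)).
  by exists phi.
(* Up to the factor [Q.+1], pairing [lam] with [|g|] bounds the loss in [val m f] when each [f j] is
   multiplied by [1 - |g|]. *)
pose lam i := \sum_(j < m) `|u (f j)| ^+ Q * (f j i * phi j (x i)).
have lamE h : \sum_i lam i * h i =
    \sum_(j < m) `|u (f j)| ^+ Q * phi j (u (fun i => f j i * h i)).
  under eq_bigr do rewrite mulr_suml.
  rewrite exchange_big; apply: eq_bigr => j _.
  rewrite linear_sum mulr_sumr; apply: eq_bigr => i _.
  by rewrite linearZ/=; ring.
have key g : (forall i, `|g i| <= 1) ->
    `|u g| ^+ Q.+1 <= d + Q.+1%:R * \sum_i lam i * `|g i|.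
  move=> g1.
  pose f' (j : 'I_m.+1) := if unlift ord0 j is Some k
    then fun i => f k i * (1 - `|g i|) else g.
  have af' : adm m.+1 f'.
    move=> i; rewrite big_ord_recl /f' unlift_none.
    under eq_bigr do rewrite liftK normrM (ger0_norm (x := 1 - _)) ?subr_ge0//.
    rewrite -mulr_suml; have := af i; have := g1 i; have := normr_ge0 (g i).
    by move: `|g i| (\sum_j _) => a b; nra.
  have := leS _ _ af'; rewrite /val big_ord_recl /f' unlift_none.
  under eq_bigr do rewrite liftK.
  (* The tangent inequality at the norm of [u (f j)]; [phi j] bounds the new norm from below. *)
  have tang j : `|u (f j)| ^+ Q.+1 -
      Q.+1%:R * (`|u (f j)| ^+ Q * phi j (u (fun i => f j i * `|g i|))) <=
      `|u (fun i => f j i * (1 - `|g i|))| ^+ Q.+1.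
    apply: le_trans (exprn_tangent_le _ (normr_ge0 (u (f j))) (normr_ge0 _)).
    rewrite lerD2l -mulrA -mulrN ler_wpM2l// -mulrN ler_wpM2l ?exprn_ge0//.
    have [phi1 phif] := phiP j.
    have uB : u (fun i => f j i * (1 - `|g i|)) =
        u (f j) - u (fun i => f j i * `|g i|).
      rewrite /u -sumrB; apply: eq_bigr => i _.
      by rewrite -scalerBl mulrBr mulr1.
    have := le_trans (ler_norm _) (phi1 (u (fun i => f j i * (1 - `|g i|)))).
    by rewrite uB linearB/= phif; lra.
  move=> le_sup; have := ler_sum (index_enum 'I_m) (fun j (_ : true) => tang j).
  rewrite sumrB -mulr_sumr -lamE -/(val m f).
  by move: le_sup fS; rewrite -/(u _); lra.
(* Testing [key] on indicators gives [lam i >= - d / Q.+1], so adding [d] makes the weights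
   nonnegative. *)
exists (fun i => lam i + d); split=> [i||g g1].
- have := key (fun j => (j == i)%:R) _; rewrite (bigD1 i)//= eqxx normr1 big1.
    rewrite addr0 mulr1 => h.
    have {}h : 0 <= d + Q.+1%:R * lam i.
      apply: le_trans (h _); first by rewrite exprn_ge0.
      by move=> j; case: eqP => _; rewrite ?normr1 ?normr0.
    have Q1 : 1 <= Q.+1%:R :> R by rewrite ler1n.
    by move: (Q.+1%:R) Q1 (lam i) h => q q1 l h; nra.
  by move=> j /negbTE ->; rewrite normr0 mulr0.
- rewrite big_split/= sumr_const card_ord -dd mulrS addrA.
  have : \sum_i lam i = val m f.
    under eq_bigr do rewrite -[lam _]mulr1.
    rewrite (lamE (fun=> 1)); apply: eq_bigr => j _; rewrite exprSr.
    have [_ phif] := phiP j; rewrite -phif; congr (_ * phi j _).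
    by apply: eq_bigr => i _; rewrite mulr1.
  by move=> ->; have := valC _ _ af; lra.
- apply: le_trans (key _ g1) _; apply: lerD => //.
  rewrite ler_wpM2l//; apply: ler_sum => i _.
  by rewrite ler_wpM2r// lerDl ltW.
Qed.

End cotype_factorization.

(** * Truncation into layers and vector-valued subgaussian sums *)

Section layers.
Context {R : realType}.

(** Truncation of [t] to the interval from [- m] to [m]. *)
Definition clip (m : nat) (t : R) : R := Num.sg t * Num.min m%:R `|t|.

Definition layer (m : nat) (t : R) : R := clip m.+1 t - clip m t.

Lemma sum_layer N (t : R) : `|t| <= N%:R -> \sum_(m < N) layer m t = t.
Proof.
move=> tN; rewrite -(big_mkord xpredT (fun m => layer m t)) telescope_sumr//.
rewrite /clip (min_idPl (normr_ge0 t)) mulr0 subr0 (min_idPr tN).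
by rewrite -numEsg.
Qed.

Lemma layer_norm m (t : R) :
  `|layer m t| <= (if `|t| <= m%:R then 0 else 1).
Proof.
rewrite /layer /clip -mulrBr normrM -natr1.
have sg1 : `|Num.sg t| <= 1 by rewrite normr_sg; case: (t != 0).
have [tm|mt] := leP `|t| m%:R.
  by rewrite !(min_idPr _) ?subrr ?normr0 ?mulr0// (le_trans tm)// lerDl.
rewrite mulr_ile1// ler_norml.
by rewrite minElt; case: ltP => h; lra.
Qed.

Lemma layer_norm_le1 m (t : R) : `|layer m t| <= 1.
Proof. by apply: le_trans (layer_norm m t) _; case: ifP. Qed.

(** The layer vanishes unless [|t| > m], and then the power of [m + 1] is at most that of [1 + |t|],
    which the exponential absorbs. *)
Lemma layer_exp_decay k m (t : R) :
  `|layer m t| <= k%:R ^+ k * expR 1 * expR `|t| / m.+1%:R ^+ k.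
Proof.
have m0 : 0 < m.+1%:R :> R by [].
apply: le_trans (layer_norm m t) _; case: (leP `|t|) => [_|mt].
  by rewrite !mulr_ge0 ?exprn_ge0 ?expR_ge0// invr_ge0 exprn_ge0.
rewrite ler_pdivlMr ?exprn_gt0// mul1r -mulrA -expRD.
apply: le_trans (exprn_le_expR k _); last by rewrite addr_ge0.
by rewrite lerXn2r ?nnegrE ?addr_ge0// -natr1 addrC lerD2l ltW.
Qed.

Lemma sum_inv_sqr_le N : \sum_(m < N) (m.+1%:R ^+ 2)^-1 <= 2 :> R.
Proof.
case: N => [|N]; first by rewrite big_ord0.
(* The sharper bound makes the induction telescope. *)
suff : \sum_(m < N.+1) (m.+1%:R ^+ 2)^-1 <= 2 - N.+1%:R^-1 :> R.
  by move=> /le_trans; apply; rewrite lerBlDr lerDl invr_ge0.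
elim: N => [|N IH].
  by rewrite big_ord_recr big_ord0/= expr1n invr1; lra.
rewrite big_ord_recr/=; apply: le_trans (lerD IH (lexx _)) _.
rewrite -[N.+2%:R]natr1; have := ltr0Sn R N; move: N.+1%:R => n n0.
have n1 : 0 < n + 1 by lra.
rewrite -subr_ge0.
have -> : 2 - (n + 1)^-1 - (2 - n^-1 + ((n + 1) ^+ 2)^-1) =
    n^-1 * ((n + 1) ^+ 2)^-1 by field; rewrite !gt_eqF.
by rewrite mulr_ge0 ?invr_ge0 ?exprn_ge0// ltW.
Qed.

(* Young-type splitting of [a] at the threshold [s ^- 2]. *)
Lemma le_split_exprn k (a s : R) : 0 <= a -> 0 < s ->
  a <= (s ^+ 2)^-1 + s ^+ (2 * k) * a ^+ k.+1.
Proof.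
move=> a0 s0; have s2 : 0 < s ^+ 2 by exact: exprn_gt0.
have p0 : 0 <= s ^+ (2 * k) * a ^+ k.+1 by rewrite mulr_ge0 ?exprn_ge0// ltW.
have [as2|/ltW as2] := leP a (s ^+ 2)^-1; first lra.
have i0 : 0 <= (s ^+ 2)^-1 by rewrite invr_ge0 ltW.
suff : a <= s ^+ (2 * k) * a ^+ k.+1 by lra.
rewrite exprM [a ^+ _]exprSr mulrA -exprMn ler_peMl//.
by rewrite exprn_ege1// mulrC -ler_pdivrMr// div1r.
Qed.

End layers.

(** This crude bound ensures that [N] layers exhaust the sum. *)
Lemma rad_sum_norm_le (R : realType) N (a : 'I_N -> R) e :
  \sum_k a k ^+ 2 <= 1 -> `|rad_sum a e| <= N%:R.
Proof.
move=> a1; apply: le_trans (ler_norm_sum _ _ _) _.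
rewrite -[leRHS]mulr1 -[N in leRHS]card_ord mulr_natl -sumr_const.
apply: ler_sum => k _; rewrite normrM normrX normrN1 expr1n mul1r.
rewrite -(@expr_le1 _ 2)// real_normK ?num_real//; apply: le_trans a1.
by rewrite (bigD1 k)//= lerDl sumr_ge0// => i _; exact: sqr_ge0.
Qed.

(** Each layer has coefficients in the unit ball of l_oo^n, so the domination theorem bounds its
    contribution by sums, against the weights [kap], of terms decaying in [m]. The bound does not
    depend on [n] or [N]. *)
Lemma rad_mean_weak_l1 (R : realType) (X : normedModType R) :
  finite_cotype X -> exists2 K : R, 0 <= K &
  forall n (x : 'I_n -> X) N (y : 'I_n -> 'I_N -> R), weak_l1_le x 1 ->
    (forall i, \sum_k y i k ^+ 2 <= 1) ->
    rad_mean (fun e => `|\sum_i rad_sum (y i) e *: x i|) <= K.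
Proof.
move=> /finite_cotype_integral[Q [C [C0 HC]]].
(* [Q.+1] comes from the domination theorem, the rest from the decay of layers with exponent
   [2 * Q.+1]: [2 * Q] offsets the splitting below and 2 gives summability. *)
pose D : R := Q.+1%:R * ((2 * Q.+1)%:R ^+ (2 * Q.+1) * expR 1).
have D0 : 0 <= D by rewrite !mulr_ge0 ?exprn_ge0 ?expR_ge0.
(* The 2 counts the threshold term and the error [delta]; [C + 1] bounds the mass of [kap], and
   [2 * expR 2] the exponential moments. *)
pose K1 := 2 + D * ((C + 1) * (2 * expR 2)).
have K10 : 0 <= K1 by rewrite addr_ge0 ?mulr_ge0 ?addr_ge0 ?expR_ge0.
exists (K1 * 2) => [|n x N y x1 y1]; first by rewrite mulr_ge0.
(* For every layer [m < N] this error is at most [(m + 1) ^- (2 * Q.+1)], the rate at which layers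
   decay. *)
pose delta : R := (N.+1%:R ^+ (2 * Q.+1))^-1.
have d0 : 0 < delta by rewrite invr_gt0 exprn_gt0.
have d1 : delta <= 1 by rewrite invf_le1 ?exprn_gt0// exprn_ege1// ler1n.
have [kap [kap0 kapC kapP]] := cotype_domination HC x1 d0.
pose W e := \sum_i kap i * expR `|rad_sum (y i) e|.
pose w m : R := (m.+1%:R ^+ 2)^-1.
have pointwise (e : {ffun 'I_N -> bool}) :
    `|\sum_i rad_sum (y i) e *: x i| <= \sum_(m < N) w m * (2 + D * W e).
  have -> : \sum_i rad_sum (y i) e *: x i =
      \sum_(m < N) \sum_i layer m (rad_sum (y i) e) *: x i.
    rewrite exchange_big; apply: eq_bigr => i _.
    by rewrite -scaler_suml sum_layer// rad_sum_norm_le.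
  apply: le_trans (ler_norm_sum _ _ _) _; apply: ler_sum => m _.
  have m0 : 0 < m.+1%:R :> R by [].
  (* Splitting at [(m + 1) ^- 2] turns a bound on the power [Q.+1] of the norm into one on the
     norm. *)
  apply: le_trans (le_split_exprn Q (normr_ge0 _) m0) _.
  have -> : w m * (2 + D * W e) = w m + m.+1%:R ^+ (2 * Q) *
      ((m.+1%:R ^+ (2 * Q.+1))^-1 + (m.+1%:R ^+ (2 * Q.+1))^-1 * D * W e).
    have -> : (m.+1%:R ^+ (2 * Q.+1))^-1 = (m.+1%:R ^+ (2 * Q))^-1 * w m :> R.
      by rewrite mulnS addnC exprD invfM.
    have : m.+1%:R ^+ (2 * Q) != 0 :> R by rewrite expf_neq0// pnatr_eq0.
    by move: (m.+1%:R ^+ (2 * Q)) => p p0; field.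
  rewrite lerD2l ler_wpM2l ?exprn_ge0//.
  apply: le_trans (kapP _ (fun i => layer_norm_le1 m _)) _.
  apply: lerD.
    rewrite lef_pV2 ?posrE ?exprn_gt0// lerXn2r ?nnegrE// ler_nat.
    by rewrite ltnW// ltnS.
  rewrite -mulrA -mulrA mulrCA -/(_ * _ * expR 1).
  rewrite [leRHS](_ : _ = Q.+1%:R * \sum_i kap i *
    ((2 * Q.+1)%:R ^+ (2 * Q.+1) * expR 1 * expR `|rad_sum (y i) e| /
      m.+1%:R ^+ (2 * Q.+1))).
    rewrite ler_wpM2l//; apply: ler_sum => i _; rewrite ler_wpM2l//.
    exact: layer_exp_decay.
  rewrite /D /W !mulr_sumr; apply: eq_bigr => i _; ring.
apply: le_trans (le_rad_mean pointwise) _.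
rewrite -[X in rad_mean X](_ : (fun e => (\sum_(m < N) w m) * (2 + D * W e)) = _);
  last by apply/funext => e; rewrite mulr_suml.
rewrite rad_meanZ mulrC; apply: ler_pM.
- apply: rad_mean_ge0 => e; rewrite addr_ge0// mulr_ge0// sumr_ge0// => i _.
  by rewrite mulr_ge0// expR_ge0.
- by apply: sumr_ge0 => m _; rewrite invr_ge0 exprn_ge0.
- rewrite rad_meanD rad_mean_cst lerD2l rad_meanZ ler_wpM2l//.
  rewrite rad_mean_sum; apply: (@le_trans _ _ (\sum_i kap i * (2 * expR 2))).
    by apply: ler_sum => i _; rewrite rad_meanZ ler_wpM2l// rad_exp.
  rewrite -mulr_suml ler_wpM2r ?mulr_ge0 ?expR_ge0//.
  by apply: le_trans kapC _; rewrite lerD2l.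
- exact: sum_inv_sqr_le.
Qed.

(** * Operators between L_1 and l_2 *)

Section lspace.
Context d (T : measurableType d) (R : realType).
Context (mu : {measure set T -> \bar R}) (p : \bar R) (p1 : (1 <= p)%E).
Implicit Types F G : LspaceType mu p1.

Lemma LspaceD F G : (F + G : T -> R) = (fun x => F x + G x) %[ae mu].
Proof. exact: LclassE. Qed.

Lemma LspaceZ a F : (a *: F : T -> R) = (fun x => a * F x) %[ae mu].
Proof. exact: LclassE. Qed.

Lemma Lspace_normE F : `|F|%:E = ('N[mu]_p[EFin \o F])%E.
Proof. exact: (finite_norm_fine (to_Lfun F)). Qed.

Lemma measurable_Lspace F : measurable_fun setT (F : T -> R).
Proof. exact: (@measurable_funPT _ _ _ _ (repr (LebesgueSpace.sort F))). Qed.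

Lemma Lfun_Lspace (f : T -> R) : f \in Lfun mu p ->
  exists2 F : LspaceType mu p1, (F : T -> R) = f %[ae mu] &
    `|F|%:E = ('N[mu]_p[EFin \o f])%E.
Proof.
move=> Lf; exists (Lclass (Lfun_Sub p1 Lf)); first exact: LclassE.
rewrite Lspace_normE; apply: Lnorm_ae_eq => //; last exact: LclassE.
  exact: measurable_Lspace.
by move: Lf => /andP[]; rewrite inE.
Qed.

End lspace.

(** * Coordinates in l_2 *)

Section ell2_coordinates.
Context {R : realType}.
Implicit Types F G : ell2 R.

(** Only the empty set is null for the counting measure. *)
Lemma ae_counting (f g : nat -> R) : f = g %[ae (@counting nat R)] -> f =1 g.
Proof.
move=> [A [_ A0 fgA]] k; apply: contrapT => fgk.
have Ak : A k by apply: fgA => /= /(_ I).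
move: A0; rewrite /counting /=; case: asboolP => // finA [] /eqP.
rewrite pnatr_eq0 finmap.cardfs_eq0 => /eqP A0.
by have := in_fset_set finA k; rewrite A0 finmap.in_fset0 mem_set.
Qed.

Lemma ell2D F G k : (F + G : ell2 R) k = F k + G k.
Proof. exact: ae_counting (LspaceD F G) k. Qed.

Lemma ell2Z a F k : (a *: F : ell2 R) k = a * F k.
Proof. exact: ae_counting (LspaceZ a F) k. Qed.

Lemma ell2_ext F G : F =1 G -> F = G.
Proof. by move=> FG; apply: Lspace_ae_eq; exact/nearW. Qed.

Lemma ell2_Lnorm (f : nat -> R) :
  ('N[@counting nat R]_2[EFin \o f] = (\sum_(k <oo) (f k ^+ 2)%:E) `^ 2^-1)%E.
Proof.
rewrite Lnorm_counting//; congr (_ `^ _)%E; apply: eq_eseriesr => k _ /=.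
by rewrite powR_mulrn// real_normK ?num_real.
Qed.

Lemma ell2_norm_sqr F : (`|F| ^+ 2)%:E = (\sum_(k <oo) (F k ^+ 2)%:E)%E.
Proof.
have s0 : (0 <= \sum_(k <oo) (F k ^+ 2)%:E)%E.
  by apply: nneseries_ge0 => k _ _; rewrite lee_fin sqr_ge0.
have := Lspace_normE F; rewrite ell2_Lnorm => FE.
rewrite -powR_mulrn// -poweR_EFin FE -poweRrM mulVf ?poweRe1//.
Qed.

Lemma ell2_sum_sqr_le F N : \sum_(k < N) F k ^+ 2 <= `|F| ^+ 2.
Proof.
rewrite -lee_fin ell2_norm_sqr -sumEFin -(big_mkord xpredT (fun k => (F k ^+ 2)%:E)).
by apply: nneseries_lim_ge => k _ _; rewrite lee_fin sqr_ge0.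
Qed.

Lemma ell2_coord_le F k : `|F k| <= `|F|.
Proof.
rewrite -(@ler_pXn2r _ 2) ?nnegrE// real_normK ?num_real//.
apply: le_trans (ell2_sum_sqr_le F k.+1); rewrite big_ord_recr/= lerDr.
by apply: sumr_ge0 => i _; exact: sqr_ge0.
Qed.

Lemma ell2_norm_cvg F : Num.sqrt (\sum_(k < N) F k ^+ 2) @[N --> \oo] --> `|F|.
Proof.
have FN : \sum_(k < N) F k ^+ 2 @[N --> \oo] --> `|F| ^+ 2.
  have : (\sum_(k < N) (F k ^+ 2)%:E)%E @[N --> \oo] --> (`|F| ^+ 2)%:E.
    rewrite ell2_norm_sqr.
    under eq_fun do rewrite -(big_mkord xpredT (fun k => (F k ^+ 2)%:E)).
    by apply: is_cvg_nneseries => k _ _; rewrite lee_fin sqr_ge0.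
  under eq_fun do rewrite sumEFin.
  by move/fine_cvg.
rewrite -[X in _ --> X](ger0_norm (normr_ge0 F)) -sqrtr_sqr.
exact: (continuous_cvg _ (@sqrt_continuous R _) FN).
Qed.

(** Serves to build an operator into l_2 from its coordinates. *)
Lemma ell2_of_seq (s : nat -> R) (c : R) : 0 <= c ->
  (forall N, \sum_(k < N) s k ^+ 2 <= c ^+ 2) ->
  exists2 F : ell2 R, (F : nat -> R) =1 s & `|F| <= c.
Proof.
move=> c0 sc.
have sum_le : (\sum_(k <oo) (s k ^+ 2)%:E <= (c ^+ 2)%:E)%E.
  apply: lime_le; first by apply: is_cvg_nneseries => k _ _; rewrite lee_fin sqr_ge0.
  by apply: nearW => N /=; rewrite big_mkord sumEFin lee_fin.
have sum0 : (0 <= \sum_(k <oo) (s k ^+ 2)%:E)%E.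
  by apply: nneseries_ge0 => k _ _; rewrite lee_fin sqr_ge0.
have N2 : ('N[@counting nat R]_2[EFin \o s] <= c%:E)%E.
  rewrite ell2_Lnorm.
  have -> : c%:E = ((c ^+ 2)%:E `^ 2^-1)%E.
    by rewrite poweR_EFin powR12_sqrt ?sqr_ge0// sqrtr_sqr ger0_norm.
  by apply: gt0_ler_poweR => //; rewrite in_itv/= leey ?sum0// lee_fin sqr_ge0.
have Ls : s \in Lfun (@counting nat R) 2.
  apply/andP; split; rewrite inE//=.
  by rewrite /finite_norm (le_lt_trans N2)// ltry.
have [F Fs Fn] := Lfun_Lspace (lee1n 2) Ls.
exists F; first exact: ae_counting.
by rewrite -lee_fin Fn.
Qed.

End ell2_coordinates.

Section l1_families.
Context {R : realType}.

Lemma cauchy_schwarz_sqrt n (a b : 'I_n -> R) :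
  \sum_k a k * b k <= Num.sqrt (\sum_k a k ^+ 2) * Num.sqrt (\sum_k b k ^+ 2).
Proof.
have s0 (c : 'I_n -> R) : 0 <= \sum_k c k ^+ 2.
  by apply: sumr_ge0 => k _; exact: sqr_ge0.
have c0 (c : 'I_n -> R) k : Num.sqrt (\sum_k c k ^+ 2) = 0 -> c k = 0.
  move=> /eqP; rewrite sqrtr_eq0 => h; apply/eqP.
  rewrite -[_ == _](@expf_eq0 _ _ 2) eq_le sqr_ge0 andbT; apply: le_trans h.
  by rewrite (bigD1 k)//= lerDl sumr_ge0// => i _; exact: sqr_ge0.
set s := Num.sqrt (\sum_k a k ^+ 2); set t := Num.sqrt (\sum_k b k ^+ 2).
have [sz|sN0] := eqVneq s 0.
  by rewrite sz mul0r big1// => k _; rewrite (c0 a k sz) mul0r.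
have [tz|tN0] := eqVneq t 0.
  by rewrite tz mulr0 big1// => k _; rewrite (c0 b k tz) mulr0.
have st : 0 < s * t by rewrite mulr_gt0// lt_neqAle eq_sym ?sN0 ?tN0 sqrtr_ge0.
have s2 : \sum_k a k ^+ 2 = s ^+ 2 by rewrite sqr_sqrtr.
have t2 : \sum_k b k ^+ 2 = t ^+ 2 by rewrite sqr_sqrtr.
have : 0 <= \sum_k (t * a k - s * b k) ^+ 2 by exact: s0.
have -> : \sum_k (t * a k - s * b k) ^+ 2 =
    t ^+ 2 * \sum_k a k ^+ 2 + s ^+ 2 * \sum_k b k ^+ 2
      - 2 * (s * t) * \sum_k a k * b k.
  rewrite !mulr_sumr -big_split -sumrB/=; apply: eq_bigr => k _; ring.
rewrite s2 t2 => h; rewrite -(@ler_pM2l _ (s * t))//.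
by rewrite -subr_ge0; move: h; lra.
Qed.

Lemma ell2_sum (I : Type) (r : seq I) (P : pred I) (F : I -> ell2 R) k :
  (\sum_(i <- r | P i) F i : ell2 R) k = \sum_(i <- r | P i) F i k.
Proof.
pose ev (G : ell2 R) := G k.
rewrite -[LHS]/(ev _); apply: (big_morph ev) => [G H|]; first exact: ell2D.
by rewrite /ev -(scale0r 0) ell2Z mul0r.
Qed.

(* The hypothesis on [u] says that it spans an isometric copy of a weighted
   [l_1], as multiples of indicators of disjoint sets do. *)
Lemma l1_family_trace (L : normedModType R) (B : {linear L -> ell2 R}) b K
    (I : finType) (u : I -> L) N (c : 'I_N -> I -> R) :
  0 <= b -> (forall F, `|B F| <= b * `|F|) ->
  (forall a : 'I_N -> R, Num.sqrt (\sum_k a k ^+ 2) <=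
     K * rad_mean (fun e => `|rad_sum a e|)) ->
  (forall h : I -> R, `|\sum_i h i *: u i| = \sum_i `|h i| * `|u i|) ->
  `|\sum_k B (\sum_i c k i *: u i) k| <=
  K * b * rad_mean (fun e : {ffun 'I_N -> bool} =>
    `|\sum_k (-1) ^+ e k *: \sum_i c k i *: u i|).
Proof.
move=> b0 Bb KP ul1.
have -> : \sum_k B (\sum_i c k i *: u i) k = \sum_i \sum_k c k i * B (u i) k.
  rewrite exchange_big; apply: eq_bigr => k _; rewrite linear_sum ell2_sum.
  by apply: eq_bigr => i _; rewrite linearZ ell2Z.
have CS (i : I) : `|\sum_k c k i * B (u i) k| <=
    Num.sqrt (\sum_k c k i ^+ 2) * (b * `|u i|).
  have sb : Num.sqrt (\sum_(k < N) B (u i) k ^+ 2) <= b * `|u i|.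
    apply: le_trans (Bb _); rewrite -[leRHS]ger0_norm// -sqrtr_sqr ler_wsqrtr//.
    exact: ell2_sum_sqr_le.
  rewrite ler_norml; apply/andP; split.
    rewrite lerNl -sumrN; under eq_bigr do rewrite -mulNr.
    apply: le_trans (cauchy_schwarz_sqrt _ _) _.
    by under eq_bigr do rewrite sqrrN; rewrite ler_wpM2l// sqrtr_ge0.
  apply: le_trans (cauchy_schwarz_sqrt _ _) _.
  by rewrite ler_wpM2l// sqrtr_ge0.
apply: le_trans (ler_norm_sum _ _ _) _.
apply: le_trans (ler_sum _ (fun i _ => CS i)) _.
(* In a weighted l_1 the Rademacher average splits over the [u i], leaving a scalar Khintchine
   inequality for each. *)
have -> : rad_mean (fun e : {ffun 'I_N -> bool} =>
    `|\sum_k (-1) ^+ e k *: \sum_i c k i *: u i|) =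
    \sum_i rad_mean (fun e => `|rad_sum (c^~ i) e|) * `|u i|.
  under [RHS]eq_bigr do rewrite mulrC -rad_meanZ.
  rewrite -rad_mean_sum; congr rad_mean; apply/funext => e.
  have -> : \sum_k (-1) ^+ e k *: (\sum_i c k i *: u i) =
      \sum_i rad_sum (c^~ i) e *: u i.
    under eq_bigr do rewrite scaler_sumr.
    rewrite exchange_big; apply: eq_bigr => i _; rewrite scaler_suml.
    by apply: eq_bigr => k _; rewrite scalerA.
  by rewrite ul1; apply: eq_bigr => i _; rewrite mulrC.
rewrite mulr_sumr; apply: ler_sum => i _.
apply: (@le_trans _ _ (K * rad_mean (fun e => `|rad_sum (c^~ i) e|) * (b * `|u i|))).
  by rewrite ler_wpM2r// mulr_ge0.
by rewrite le_eqVlt; apply/orP; left; apply/eqP; ring.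
Qed.

End l1_families.

(** * Simple functions in L_1 and the trace inequality *)

Section L1_density.
Context d (T : measurableType d) (R : realType).
Context (nu : {measure set T -> \bar R}).
Let L1 : normedModType R := LspaceType1 nu.

Lemma L1_norm_ae (F : L1) (f : T -> R) : measurable_fun setT f ->
  (F : T -> R) = f %[ae nu] -> `|F|%:E = (\int[nu]_x `|(f x)%:E|)%E.
Proof.
move=> mf Ff; rewrite Lspace_normE -Lnorm1; apply: Lnorm_ae_eq => //.
exact: measurable_Lspace.
Qed.

Lemma L1_sum_ae (I : Type) (r : seq I) (a : I -> R) (F : I -> L1) (f : I -> T -> R) :
  (forall i, (F i : T -> R) = f i %[ae nu]) ->
  ((\sum_(i <- r) a i *: F i : L1) : T -> R) =
    (fun x => \sum_(i <- r) a i * f i x) %[ae nu].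
Proof.
move=> Ff; elim: r => [|i r IH].
  rewrite big_nil; apply: filterS (LclassE (0 : LfunType nu (lexx 1%E))) => x.
  by move=> /(_ Logic.I) x0 _; rewrite /= big_nil; exact: x0.
rewrite big_cons.
apply: filterS (filterI (LspaceD (a i *: F i) (\sum_(j <- r) a j *: F j))
  (filterI (LspaceZ (a i) (F i)) (filterI (Ff i) IH))).
move=> x [/(_ Logic.I) + [/(_ Logic.I) + [/(_ Logic.I) + /(_ Logic.I) +]]] _.
by rewrite big_cons => -> -> -> ->.
Qed.

(** Infinite measure of a set where [g] is a nonzero constant would make the integral of [|g|]
    infinite. *)
Lemma integrable_level_set (g : T -> R) (A : set T) (v : R) :
  measurable A -> nu.-integrable setT (EFin \o g) -> (forall x, A x -> g x = v) ->
  v != 0 -> (nu A < +oo)%E.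
Proof.
move=> mA ig gv v0; rewrite ltey; apply/eqP => Aoo.
have /integrableP[mg] := ig; rewrite ltNge => /negP; apply.
apply: (@le_trans _ _ (\int[nu]_(x in A) `|(g x)%:E|)%E); last first.
  by apply: ge0_subset_integral => //; exact: measurableT_comp.
rewrite (eq_integral (cst `|v|%:E)) => [|x]; last by rewrite inE => /gv ->.
by rewrite integral_cst// Aoo gt0_muley// lte_fin normr_gt0.
Qed.

(* The [u i] are indicators of the joint level sets of the [g k]. *)
Lemma L1_joint_level_sets N (g : 'I_N -> {sfun T >-> R}) :
  (forall k, nu.-integrable setT (EFin \o g k)) ->
  exists (I : finType) (u : I -> L1) (c : 'I_N -> I -> R),
    (forall h : I -> R, `|\sum_i h i *: u i| = \sum_i `|h i| * `|u i|) /\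
    forall k, ((\sum_i c k i *: u i : L1) : T -> R) = g k %[ae nu].
Proof.
move=> ig.
have /choice[s gs] : forall k, exists s : seq R, range (g k) = [set` s].
  by move=> k; apply/finite_seqP; exact: fimfunP.
pose S := undup (flatten [seq s k | k <- enum 'I_N]).
have uS : uniq S by exact: undup_uniq.
have gS k x : g k x \in S.
  rewrite mem_undup; apply/flattenP; exists (s k).
    by apply/map_f; rewrite mem_enum.
  have : range (g k) (g k x) by exists x.
  by rewrite gs.
pose I := {ffun 'I_N -> 'I_(size S)}.
pose c (k : 'I_N) (w : I) := S`_(w k).
pose A (w : I) := [set x | forall k, g k x = c k w].
have mA w : measurable (A w).
  have -> : A w = \bigcap_(k in [set: 'I_N]) (g k @^-1` [set c k w]).
    by apply/seteqP; split=> [x Ax k _|x Ax k]; [exact: Ax|exact: Ax k Logic.I].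
  by apply: fin_bigcap_measurable => // k _; exact: measurable_funPTI.
have disjA w w' x : A w x -> A w' x -> w = w'.
  move=> Aw Aw'; apply/ffunP => k; apply/val_inj/eqP.
  by rewrite -(nth_uniq 0 (ltn_ord _) (ltn_ord _) uS) -[_`_(w k)]Aw -[_`_(w' k)]Aw'.
have covA x : exists w, A w x.
  have iS k : (index (g k x) S < size S)%N by rewrite index_mem.
  exists [ffun k => Ordinal (iS k)] => k.
  by rewrite /c ffunE/= nth_index.
(* Level sets of infinite measure get the zero function; every [g k] vanishes on them by
   integrability, so nothing is lost. *)
pose f w : T -> R := if `[< (nu (A w) < +oo)%E >] then \1_(A w) else cst 0.
have f0 w x : ~ A w x -> f w x = 0.
  by move=> nA; rewrite /f; case: asboolP => //= _; rewrite indicE memNset.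
have Lf w : f w \in Lfun nu 1.
  apply/Lfun1_integrable; rewrite /f; case: asboolP => [Afin|_].
    apply/integrableP; split; first exact/measurable_EFinP/measurable_indic.
    under eq_integral do rewrite gee0_abs ?lee_fin//.
    by rewrite integral_indic// setIT.
  exact: integrable0.
have mf w : measurable_fun setT (f w).
  by move: (Lf w) => /andP[]; rewrite inE.
have /choice[u uf] w : exists F : L1, (F : T -> R) = f w %[ae nu].
  by have [F Ff _] := Lfun_Lspace (lexx 1%E) (Lf w); exists F.
have mh (h : I -> R) : measurable_fun setT (fun x => \sum_w h w * f w x).
  by apply: measurable_sum => w; exact: measurable_funM.
have at_x (h : I -> R) w x : A w x -> \sum_w' h w' * f w' x = h w * f w x.
  move=> Aw; rewrite (bigD1 w)//= big1 ?addr0// => w' ww'.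
  by rewrite f0 ?mulr0// => Aw'; move/eqP: ww'; apply; exact: disjA Aw' Aw.
exists I, u, c; split=> [h|k].
  apply: EFin_inj; rewrite (L1_norm_ae (mh h) (L1_sum_ae _ _ uf)) -sumEFin.
  transitivity (\int[nu]_x \sum_w (`|h w| * `|f w x|)%:E)%E.
    apply: eq_integral => x _; have [w Aw] := covA x.
    rewrite sumEFin (at_x _ w)// abse_EFin normrM; congr EFin.
    rewrite (bigD1 w)//= big1 ?addr0// => w' ww'.
    by rewrite f0 ?normr0 ?mulr0// => Aw'; move/eqP: ww'; apply; exact: disjA Aw' Aw.
  rewrite ge0_integral_sum//; last first.
    by move=> w; apply/measurable_EFinP/measurable_funM => //; exact: measurableT_comp.
  apply: eq_bigr => w _; rewrite EFinM (L1_norm_ae (mf w) (uf w)).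
  under eq_integral do rewrite EFinM.
  by rewrite ge0_integralZl_EFin//; exact/measurable_EFinP/measurableT_comp.
apply: filterS (L1_sum_ae (index_enum I) (c k) uf) => x /(_ Logic.I) + _.
move=> ->; have [w Aw] := covA x; rewrite (at_x _ w)// Aw.
rewrite /f; case: asboolP => [_|nfin].
  by rewrite indicE mem_set// mulr1.
have [->|cN0] := eqVneq (c k w) 0; first by rewrite mul0r.
by case: nfin; apply: (integrable_level_set (mA w) (ig k) _ cN0) => y; exact.
Qed.

(** Integrable simple functions are dense in L_1, and finitely many of them share joint level
    sets. *)
Lemma L1_approx_level_sets N (f : 'I_N -> L1) (eps : R) : 0 < eps ->
  exists (I : finType) (u : I -> L1) (c : 'I_N -> I -> R),
    (forall h : I -> R, `|\sum_i h i *: u i| = \sum_i `|h i| * `|u i|) /\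
    forall k, `|f k - \sum_i c k i *: u i| <= eps.
Proof.
move=> e0.
have intf k : nu.-integrable setT (EFin \o f k).
  by apply/Lfun1_integrable; exact: (LfunP (to_Lfun (f k))).
have /choice[g gP] k : exists g : {sfun T >-> R},
    nu.-integrable setT (EFin \o g) /\
    (\int[nu]_x `|(f k x)%:E - (g x)%:E| <= eps%:E)%E.
  have [G [iG _]] := approximation_sfun_integrable measurableT (intf k).
  move=> /fine_cvgP[fin]; move/cvgrPdist_le => /(_ _ e0) near.
  have [n [finn nearn]] := filter_ex (filterI fin near).
  exists (G n); split=> //; rewrite -(fineK finn) lee_fin.
  by move: nearn; rewrite /= sub0r normrN; apply: le_trans; exact: ler_norm.
have [I [u [c [ul1 uc]]]] := L1_joint_level_sets (fun k => (gP k).1).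
exists I, u, c; split=> // k.
have mg : measurable_fun setT (fun x => f k x - g k x).
  by apply: measurable_funB => //; exact: measurable_Lspace.
rewrite -lee_fin (@L1_norm_ae _ _ mg).
  by under eq_integral do rewrite EFinB; exact: (gP k).2.
rewrite -scaleN1r.
apply: filterS (filterI (LspaceD (f k) (-1 *: \sum_i c k i *: u i))
  (filterI (LspaceZ (-1) (\sum_i c k i *: u i)) (uc k))).
move=> x [/(_ Logic.I) + [/(_ Logic.I) + /(_ Logic.I) +]] _.
by move=> -> -> ->; rewrite mulN1r.
Qed.

(** A trace form of the little Grothendieck inequality: it holds on spans of level sets and passes
    to all families by approximation. *)
Lemma L1_rademacher_trace (B : {linear L1 -> ell2 R}) : continuous B ->
  exists2 K : R, 0 <= K & forall N (f : 'I_N -> L1),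
    `|\sum_k B (f k) k| <=
    K * rad_mean (fun e : {ffun 'I_N -> bool} => `|\sum_k (-1) ^+ e k *: f k|).
Proof.
move=> /linear_bounded_continuous/linear_boundedP/pinfty_ex_gt0[b b0 Bb].
have [K K0 KP] := @khintchine R.
have Kb0 : 0 <= K * b by rewrite mulr_ge0// ltW.
exists (K * b) => // N f; apply/ler_addgt0Pr => e e0.
(* Collects the errors of the trace and of the Rademacher average; the added 1 makes it positive. *)
pose D := N%:R * b + K * b * N%:R + 1.
have D0 : 0 < D by rewrite ltr_wpDl// addr_ge0// mulr_ge0// ltW.
have [I [u [c [ul1 fu]]]] := L1_approx_level_sets f (divr_gt0 e0 D0).
set eps := e / D in fu.
have eps0 : 0 <= eps by rewrite divr_ge0// ltW.
set g := fun k => \sum_i c k i *: u i.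
have sN (x : R) : \sum_(k < N) x = N%:R * x.
  by rewrite sumr_const card_ord mulr_natl.
have Bfg : `|\sum_k B (f k) k| <= `|\sum_k B (g k) k| + N%:R * (b * eps).
  have -> : \sum_k B (f k) k = \sum_k B (g k) k + \sum_k B (f k - g k) k.
    rewrite -big_split/=; apply: eq_bigr => k _.
    by rewrite -ell2D -linearD addrC subrK.
  apply: le_trans (ler_normD _ _) _; rewrite lerD2l -sN.
  apply: le_trans (ler_norm_sum _ _ _) _; apply: ler_sum => k _.
  apply: le_trans (ell2_coord_le _ _) _; apply: le_trans (Bb _) _.
  by rewrite ler_wpM2l// ltW.
have rfg : rad_mean (fun e : {ffun 'I_N -> bool} => `|\sum_k (-1) ^+ e k *: g k|) <=
    rad_mean (fun e : {ffun 'I_N -> bool} => `|\sum_k (-1) ^+ e k *: f k|) + N%:R * eps.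
  rewrite -[X in _ + X](rad_mean_cst N) -rad_meanD; apply: le_rad_mean => s.
  have -> : \sum_k (-1) ^+ s k *: g k =
      \sum_k (-1) ^+ s k *: f k - \sum_k (-1) ^+ s k *: (f k - g k).
    rewrite -sumrB; apply: eq_bigr => k _.
    by rewrite -scalerBr opprB addrC subrK.
  apply: le_trans (ler_normB _ _) _; rewrite lerD2l -sN.
  apply: le_trans (ler_norm_sum _ _ _) _; apply: ler_sum => k _.
  by rewrite normrZ normrX normrN1 expr1n mul1r.
have gK := l1_family_trace c (ltW b0) Bb (KP N) ul1.
apply: le_trans Bfg _; apply: le_trans (lerD gK (lexx _)) _.
apply: le_trans (lerD (ler_wpM2l Kb0 rfg) (lexx _)) _.
rewrite mulrDr -addrA lerD2l.
have -> : K * b * (N%:R * eps) + N%:R * (b * eps) = (N%:R * b + K * b * N%:R) * eps.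
  ring.
by rewrite /eps mulrA ler_pdivrMr// mulrC ler_pM2l// lerDl.
Qed.

End L1_density.

(** * The tensor norm dual to the 1-summing norm *)

Lemma linear_le_continuous (R : realType) (V W : normedModType R)
    (f : {linear V -> W}) (c : R) :
  (forall x, `|f x| <= c * `|x|) -> continuous f.
Proof.
move=> fc; apply/linear_bounded_continuous/linear_boundedP.
exists c; split=> [|r cr x]; first exact: num_real.
by apply: le_trans (fc x) _; rewrite ler_wpM2r// ltW.
Qed.

Lemma continuous_linear_le (R : realType) (V W : normedModType R)
    (f : {linear V -> W}) : continuous f ->
  exists2 c : R, 0 < c & forall x, `|f x| <= c * `|x|.
Proof. by move=> /linear_bounded_continuous/linear_boundedP/pinfty_ex_gt0. Qed.

Section glue.
Context (A : Type) (n m : nat) (a : 'I_n -> A) (b : 'I_m -> A).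

Definition glue (i : 'I_(n + m)) : A :=
  match fintype.split i with inl j => a j | inr j => b j end.

Lemma glue_lshift i : glue (lshift m i) = a i.
Proof. by rewrite /glue -[lshift m i]/(unsplit (inl i)) unsplitK. Qed.

Lemma glue_rshift i : glue (rshift n i) = b i.
Proof. by rewrite /glue -[rshift n i]/(unsplit (inr i)) unsplitK. Qed.

End glue.

(** * Finitely supported sequences as tensors *)

Section finite_sequences.
Context {R : realType} {X : lmodType R}.

Definition finsupp : {pred nat -> X} :=
  mem [set s : nat -> X | exists N, forall k, (N <= k)%N -> s k = 0].

Let finsupp_closed : submod_closed finsupp.
Proof.
split=> [|a s t]; rewrite !inE /=; first by exists 0%N.
move=> [N sN] [M tM]; exists (maxn N M) => k; rewrite geq_max => /andP[Nk Mk].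
by rewrite /GRing.add/= /GRing.scale/= sN// tM// scaler0 addr0.
Qed.

HB.instance Definition _ := GRing.isSubmodClosed.Build _ _ finsupp finsupp_closed.

Definition finseq := {s : nat -> X | s \in finsupp}.
HB.instance Definition _ := SubChoice.on finseq.
HB.instance Definition _ := [SubChoice_isSubLmodule of finseq by <:].

Definition seq_of (s : finseq) : nat -> X := val s.
Coercion seq_of : finseq >-> Funclass.

Lemma finseqD (s t : finseq) k : seq_of (s + t) k = s k + t k. Proof. by []. Qed.
Lemma finseqZ a (s : finseq) k : seq_of (a *: s) k = a *: s k. Proof. by []. Qed.
Lemma finseq0 k : seq_of 0 k = 0. Proof. by []. Qed.

Lemma finseq_sum (I : Type) (r : seq I) (P : pred I) (s : I -> finseq) k :
  seq_of (\sum_(i <- r | P i) s i) k = \sum_(i <- r | P i) s i k.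
Proof. exact: (big_morph (fun s : finseq => s k)). Qed.

Lemma finseqP (s : finseq) : exists N, forall k, (N <= k)%N -> s k = 0.
Proof. by have := valP s; rewrite inE. Qed.

Definition single_fun (k : nat) (x : X) : nat -> X := fun j => if j == k then x else 0.

Let single_subproof k x : single_fun k x \in finsupp.
Proof.
rewrite inE /=; exists k.+1 => j kj.
by rewrite /single_fun gtn_eqF.
Qed.

Definition single k x : finseq := exist (fun s => s \in finsupp) _ (single_subproof k x).

Lemma singleE k x j : single k x j = if j == k then x else 0.
Proof. by []. Qed.

Lemma singleD k x y : single k (x + y) = single k x + single k y.
Proof.
apply/val_inj/funext => j; rewrite [LHS]singleE [RHS]finseqD !singleE.
by case: eqP; rewrite ?addr0.
Qed.

Lemma singleZ k a x : single k (a *: x) = a *: single k x.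
Proof.
apply/val_inj/funext => j; rewrite [LHS]singleE [RHS]finseqZ !singleE.
by case: eqP; rewrite ?scaler0.
Qed.

End finite_sequences.
Arguments finseq {R} X.

Section tensor_norm.
Context {R : realType} {X : normedModType R}.
Implicit Types s t : finseq X.

(* [s] stands for the tensor [\sum_k e_k (x) s_k] of [l_2 (x) X]; [tensor_le s W]
   writes it as [\sum_i y_i (x) x_i] with [y_i] in the unit ball. *)
Definition tensor_le s (W : R) := 0 < W /\
  exists n (x : 'I_n -> X) (y : 'I_n -> nat -> R),
    [/\ weak_l1_le x W, forall i N, \sum_(k < N) y i k ^+ 2 <= 1 &
      forall k, s k = \sum_i y i k *: x i].

(** Take the [y_i] to be unit vectors and [x_i = s i]; the added 1 makes [W] positive. Thus the
    infimum in [tensor_norm] is over a nonempty set. *)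
Lemma tensor_le_ex s : exists W, tensor_le s W.
Proof.
have [N sN] := finseqP s.
exists (\sum_(k < N) `|s k| + 1); split.
  by rewrite ltr_wpDl// sumr_ge0.
exists N, (fun k => s k), (fun i k => (k == i :> nat)%:R); split.
- move=> phi phi1; rewrite -[leLHS]addr0 lerD//; apply: ler_sum => i _.
  exact: phi1.
- move=> i M; have [iM|Mi] := ltnP i M; last first.
    rewrite big1// => k _; rewrite (ltn_eqF (leq_trans (ltn_ord k) Mi)).
    by rewrite expr0n.
  rewrite (bigD1 (Ordinal iM))//= eqxx expr1n big1 ?addr0// => k /eqP ki.
  by case: eqP => [h|_]; [case: ki; exact: val_inj|rewrite expr0n].
- move=> k; have [kN|Nk] := ltnP k N; last first.
    rewrite sN// big1// => i _.
    by rewrite (gtn_eqF (leq_trans (ltn_ord i) Nk)) scale0r.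
  rewrite (bigD1 (Ordinal kN))//= eqxx scale1r big1 ?addr0// => i /eqP ik.
  by case: eqP => [h|_]; [case: ik; exact: val_inj|rewrite scale0r].
Qed.

(** Representations are concatenated, and their weak l_1 bounds add. *)
Lemma tensor_leD s t W V : tensor_le s W -> tensor_le t V ->
  tensor_le (s + t) (W + V).
Proof.
move=> [W0 [n [x [y [xW y1 sE]]]]] [V0 [m [x' [y' [xV y1' tE]]]]].
split; first exact: addr_gt0.
exists (n + m)%N, (glue x x'), (glue y y'); split.
- move=> phi phi1; rewrite big_split_ord/=.
  under eq_bigr do rewrite glue_lshift.
  under [X in _ + X]eq_bigr do rewrite glue_rshift.
  by rewrite lerD ?xW ?xV.
- move=> i N; rewrite -[i]splitK; case: (fintype.split i) => j /=.
    by under eq_bigr do rewrite glue_lshift; exact: y1.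
  by under eq_bigr do rewrite glue_rshift; exact: y1'.
- move=> k; rewrite finseqD sE tE big_split_ord/=.
  under [in RHS]eq_bigr do rewrite !glue_lshift.
  by under [in X in _ = _ + X]eq_bigr do rewrite !glue_rshift.
Qed.

Lemma tensor_leZ a s W : 0 < a -> tensor_le s W -> tensor_le (a *: s) (a * W).
Proof.
move=> a0 [W0 [n [x [y [xW y1 sE]]]]]; split; first exact: mulr_gt0.
exists n, (fun i => a *: x i), y; split=> // [phi phi1|k].
  under eq_bigr do rewrite linearZ normrM gtr0_norm//.
  by rewrite -mulr_sumr ler_pM2l//; exact: xW.
rewrite finseqZ sE scaler_sumr; apply: eq_bigr => i _.
by rewrite !scalerA mulrC.
Qed.

Lemma tensor_le0 W : 0 < W -> tensor_le 0 W.
Proof.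
move=> W0; split=> //; exists 0%N, (fun=> 0), (fun=> fun=> 0); split=> [phi _|[]//|k].
  by rewrite big_ord0 ltW.
by rewrite big_ord0.
Qed.

Definition tensor_norm s := inf [set W | tensor_le s W].

Lemma tensor_norm_le s W : tensor_le s W -> tensor_norm s <= W.
Proof. by move=> sW; apply: ge_inf => //; exists 0 => V [/ltW]. Qed.

Lemma le_tensor_norm s c : (forall W, tensor_le s W -> c <= W) ->
  c <= tensor_norm s.
Proof. by move=> h; apply: lb_le_inf => //; exact: tensor_le_ex. Qed.

Lemma sublinear_tensor_norm K : 0 < K -> sublinear (fun s => K * tensor_norm s).
Proof.
move=> K0; apply: sublinearP => [s t||a s a0].
- rewrite -mulrDr ler_pM2l// -lerBlDr; apply: le_tensor_norm => W sW.
  rewrite lerBlDr -lerBlDl; apply: le_tensor_norm => V tV.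
  by rewrite lerBlDl; apply: tensor_norm_le; exact: tensor_leD.
- rewrite (_ : tensor_norm 0 = 0) ?mulr0//; apply/eqP; rewrite eq_le.
  apply/andP; split; last by apply: le_tensor_norm => W [/ltW].
  apply/ler_addgt0Pr => e e0; rewrite add0r.
  by apply: tensor_norm_le; exact: tensor_le0.
- rewrite mulrCA ler_pM2l// -ler_pdivrMl//; apply: le_tensor_norm => W sW.
  by rewrite ler_pdivrMl//; apply: tensor_norm_le; exact: tensor_leZ.
Qed.

Lemma weak_l1_sup n (x : 'I_n -> X) :
  weak_l1_le x (sup [set \sum_(i < n) `|phi (x i)| | phi in @dual_ball R X]).
Proof.
move=> phi phi1; apply: ub_le_sup; last by exists phi.
exists (\sum_(i < n) `|x i|) => _ [psi psi1 <-]; apply: ler_sum => i _.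
exact: psi1.
Qed.

Lemma weak_l1_weaken n (x : 'I_n -> X) W V :
  W <= V -> weak_l1_le x W -> weak_l1_le x V.
Proof. by move=> WV xW phi /xW/le_trans; apply. Qed.

(* Trace duality: functionals dominated by the tensor norm are the 1-summing
   operators into l_2. *)
Lemma one_summing_of_functional K (g : {scalar finseq X}) : 0 < K ->
  (forall s, g s <= K * tensor_norm s) ->
  exists T : {linear X -> ell2 R}, one_summing T /\
    forall x k, T x k = g (single k x).
Proof.
move=> K0 gK; pose t x k := g (single k x).
(* Pair [g] with the tensor whose [y i] is the normalised truncation of [t (x i)] to [N]
   coordinates: its value is the sum on the left. *)
have partial n (x : 'I_n -> X) W N : 0 < W -> weak_l1_le x W ->
    \sum_i Num.sqrt (\sum_(k < N) t (x i) k ^+ 2) <= K * W.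
  move=> W0 xW; pose r i := Num.sqrt (\sum_(k < N) t (x i) k ^+ 2).
  have r2 i : \sum_(k < N) t (x i) k ^+ 2 = r i ^+ 2.
    by rewrite sqr_sqrtr// sumr_ge0// => k _; exact: sqr_ge0.
  (* Where [r i = 0], division by zero makes [y i] zero. *)
  pose y i k := if (k < N)%N then t (x i) k / r i else 0.
  pose s : finseq X := \sum_i \sum_(k < N) y i k *: single k (x i).
  have sW : tensor_le s W.
    split=> //; exists n, x, y; split=> // [i M|k].
      apply: (@le_trans _ _ (\sum_(k < N) (t (x i) k / r i) ^+ 2)).
        pose F (j : nat) := y i j ^+ 2.
        have F0 j : 0 <= F j by exact: sqr_ge0.
        have -> : \sum_(k < N) (t (x i) k / r i) ^+ 2 = \sum_(k < N) F k.
          by apply: eq_bigr => k _; rewrite /F /y ltn_ord.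
        rewrite -!(big_mkord xpredT F).
        have [MN|/ltnW NM] := leqP M N.
          by rewrite (big_cat_nat _ MN)//= lerDl sumr_ge0.
        rewrite (big_cat_nat _ NM)//= -[leRHS]addr0 lerD2l big_nat_cond big1//.
        by move=> j; rewrite andbT => /andP[Nj _]; rewrite /F /y ltnNge Nj/= expr0n.
      under eq_bigr do rewrite expr_div_n.
      rewrite -mulr_suml r2; have [->|rN0] := eqVneq (r i) 0.
        by rewrite expr0n/= mul0r.
      by rewrite divff// expf_neq0.
    rewrite finseq_sum; apply: eq_bigr => i _; rewrite finseq_sum.
    under eq_bigr do rewrite finseqZ singleE.
    have [kN|Nk] := ltnP k N; last first.
      rewrite big1 => [|j _]; first by rewrite /y ltnNge Nk scale0r.
      by rewrite (gtn_eqF (leq_trans (ltn_ord j) Nk)) scaler0.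
    rewrite (bigD1 (Ordinal kN))//= eqxx big1 ?addr0// => j /eqP jk.
    by case: eqP => [h|_]; [case: jk; exact: val_inj|rewrite scaler0].
  apply: le_trans (_ : g s <= _); last first.
    by apply: le_trans (gK s) _; rewrite ler_pM2l//; exact: tensor_norm_le.
  rewrite linear_sum; apply: ler_sum => i _; rewrite linear_sum.
  under [leRHS]eq_bigr do rewrite linearZ /y ltn_ord.
  rewrite -/(r i) /= (eq_bigr (fun k : 'I_N => (r i)^-1 * t (x i) k ^+ 2)); last first.
    by move=> k _; rewrite -/(t _ _) expr2 mulrA [_^-1 * _]mulrC.
  rewrite -mulr_sumr r2; have [->|rN0] := eqVneq (r i) 0.
    by rewrite expr0n mulr0.
  by rewrite expr2 mulKf.
have one x N : \sum_(k < N) t x k ^+ 2 <= (K * `|x|) ^+ 2.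
  have x0 : 0 <= K * `|x| by rewrite mulr_ge0// ltW.
  have S0 : 0 <= \sum_(k < N) t x k ^+ 2.
    by apply: sumr_ge0 => k _; exact: sqr_ge0.
  rewrite -[leLHS]sqr_sqrtr// lerXn2r ?nnegrE ?sqrtr_ge0//.
  (* The slack keeps [W] positive even when [x = 0]. *)
  apply/ler_addgt0Pr => e e0.
  have eK : 0 < e / K by rewrite divr_gt0.
  have := @partial 1%N (fun=> x) (`|x| + e / K) N.
  rewrite big_ord_recl big_ord0 addr0 mulrDr [K * (e / K)]mulrC divfK ?gt_eqF//.
  apply; first by rewrite ltr_wpDl.
  move=> phi phi1; rewrite big_ord_recl big_ord0 addr0.
  by apply: le_trans (phi1 x) _; rewrite lerDl ltW.
have /choice[T TE] x : exists F : ell2 R, (F : nat -> R) =1 t x /\ `|F| <= K * `|x|.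
  have Kx : 0 <= K * `|x| by rewrite mulr_ge0// ltW.
  by have [F] := ell2_of_seq Kx (one x); exists F.
have Tadd : zmod_morphism T.
  move=> x y; apply: ell2_ext => k.
  rewrite -(scaleN1r y) -(scaleN1r (T y)) ell2D ell2Z !(TE _).1 /t.
  by rewrite singleD singleZ linearD linearZ.
have Tlin : scalable T.
  by move=> a x; apply: ell2_ext => k; rewrite ell2Z !(TE _).1 /t singleZ linearZ.
pose T' : {linear X -> ell2 R} := HB.pack_for {linear X -> ell2 R} T
  (GRing.isZmodMorphism.Build _ _ _ Tadd) (GRing.isScalable.Build _ _ _ _ _ Tlin).
exists T'; split; last by move=> x k; exact: (TE x).1.
split; first by apply: (@linear_le_continuous _ _ _ _ K) => x; exact: (TE x).2.
exists K => n x; set S := sup _; apply/ler_addgt0Pr => e e0.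
have eK : 0 < e / K by rewrite divr_gt0.
have S0 : 0 <= S.
  have [phi phi1 _] := norming_functional (0 : X).
  by apply: le_trans (weak_l1_sup x phi1); apply: sumr_ge0.
have -> : K * S + e = K * (S + e / K).
  by rewrite mulrDr [K * (e / K)]mulrC divfK ?gt_eqF.
(* Letting [N] grow turns the truncated norms into norms in l_2. *)
have cvgT : \sum_i Num.sqrt (\sum_(k < N) T (x i) k ^+ 2) @[N --> \oo] -->
    \sum_(i < n) `|T (x i)|.
  by apply: cvg_big => [|i _]; [exact: add_continuous|exact: ell2_norm_cvg].
apply: (cvgr_to_le cvgT); apply: nearW => N.
rewrite (eq_bigr (fun i => Num.sqrt (\sum_(k < N) t (x i) k ^+ 2))); last first.
  by move=> i _; congr Num.sqrt; apply: eq_bigr => k _; rewrite (TE _).1.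
apply: partial; first by rewrite ltr_wpDl.
by apply: weak_l1_weaken (weak_l1_sup x); rewrite lerDl ltW.
Qed.

End tensor_norm.

(** * Extension from the subspace and restriction to it *)

Section extension.
Context {R : realType} {X : normedModType R} (E : submodClosed X).

(** The trace is bounded by the Rademacher average of the [A (t k)], hence by that of the [t k],
    whose norms agree in the subspace and in [X]; finite cotype bounds the latter. The [x i] may lie
    outside the subspace. *)
Lemma rad_trace_weak_l1 (T : {linear linear_subspace E -> ell2 R}) :
  finite_cotype X -> factors_through_L1 T ->
  exists2 K : R, 0 < K & forall n (x : 'I_n -> X) (y : 'I_n -> nat -> R) W N
    (t : 'I_N -> linear_subspace E),
    0 < W -> weak_l1_le x W -> (forall i, \sum_(k < N) y i k ^+ 2 <= 1) ->
    (forall k, val (t k) = \sum_i y i k *: x i) ->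
    \sum_k T (t k) k <= K * W.
Proof.
move=> cotX [disp [Om [nu [A [B [cA cB TBA]]]]]].
have [K1 K10 HB] := L1_rademacher_trace cB.
have [a a0 HA] := continuous_linear_le cA.
have [K2 K20 HX] := rad_mean_weak_l1 cotX.
have aK2 : 0 <= a * K2 by rewrite mulr_ge0// ltW.
have K0 : 0 <= K1 * (a * K2) by rewrite mulr_ge0.
exists (K1 * (a * K2) + 1) => [|n x y W N t W0 xW y1 tE]; first by rewrite ltr_wpDl.
apply: (@le_trans _ _ (K1 * (a * K2) * W)); last by rewrite ler_pM2r// lerDl.
have -> : \sum_k T (t k) k = \sum_k B (A (t k)) k.
  by apply: eq_bigr => k _; rewrite TBA.
apply: le_trans (ler_norm _) _; apply: le_trans (HB _ (fun k => A (t k))) _.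
rewrite -!mulrA ler_wpM2l//.
have xW1 : weak_l1_le (fun i => W^-1 *: x i) 1.
  move=> phi phi1; under eq_bigr do rewrite linearZ normrM gtr0_norm ?invr_gt0//.
  by rewrite -mulr_sumr ler_pdivrMl// mulr1; exact: xW.
have mean_le := HX n _ N (fun i k => y i k) xW1 y1.
rewrite -(ler_pM2l W0) -rad_meanZ [W * K2]mulrC in mean_le.
rewrite -(ler_pM2l a0) -rad_meanZ in mean_le.
apply: le_trans mean_le; apply: le_rad_mean => e.
have -> : \sum_k (-1) ^+ e k *: A (t k) = A (\sum_k (-1) ^+ e k *: t k).
  by rewrite linear_sum; apply: eq_bigr => k _; rewrite linearZ.
apply: le_trans (HA _) _; rewrite ler_pM2l//.
have -> : `|\sum_k (-1) ^+ e k *: t k| = `|\sum_k (-1) ^+ e k *: val (t k)|.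
  rewrite -[LHS]/(`|val (\sum_k (-1) ^+ e k *: t k)|) linear_sum.
  by congr (`|_|); apply: eq_bigr => k _; rewrite linearZ.
have -> : \sum_k (-1) ^+ e k *: val (t k) =
    W *: \sum_i rad_sum (fun k : 'I_N => y i k) e *: (W^-1 *: x i).
  rewrite scaler_sumr; under eq_bigr do rewrite tE scaler_sumr.
  rewrite exchange_big; apply: eq_bigr => i _.
  rewrite !scalerA [W * _]mulrC mulfK ?gt_eqF// /rad_sum scaler_suml.
  by apply: eq_bigr => k _; rewrite scalerA.
by rewrite normrZ gtr0_norm.
Qed.

(** The trace functional on sequences in the subspace is dominated by a multiple of the tensor norm
    of [X]; a Hahn-Banach extension of it is represented by a 1-summing operator on [X]. *)
Lemma one_summing_extension (T : {linear linear_subspace E -> ell2 R}) :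
  finite_cotype X -> factors_through_L1 T ->
  exists T' : {linear X -> ell2 R},
    one_summing T' /\ forall x : linear_subspace E, T' (val x) = T x.
Proof.
move=> cotX /(rad_trace_weak_l1 cotX)[K K0 HK].
(* Outside the subspace the default gives [T 0 = 0]; [TX] is used as a linear map on the subspace
   only. *)
pose TX x := T (insubd (0 : linear_subspace E) x).
have TXE (x : linear_subspace E) : TX (val x) = T x by rewrite /TX valKd.
have TX0 : TX 0 = 0 by rewrite -[X in TX X]/(val (0 : linear_subspace E)) TXE linear0.
pose F := [set s : finseq X | forall k, s k \in E].
have [N NP] : {N : finseq X -> nat | forall s k, (N s <= k)%N -> s k = 0}.
  have [N NP] := choice (@finseqP R X); by exists N.
(* [N s] is one choice of support bound; [fE] shows that [f] does not depend on it. *)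
pose f s := \sum_(k < N s) TX (s k) k.
have fE (s : finseq X) M : (forall k, (M <= k)%N -> s k = 0) -> f s = \sum_(k < M) TX (s k) k.
  pose G k := TX (s k) k.
  have aux P Q : (P <= Q)%N -> (forall k, (P <= k)%N -> s k = 0) ->
      \sum_(k < P) G k = \sum_(k < Q) G k.
    move=> PQ sP; rewrite -!(big_mkord xpredT G) (big_cat_nat _ PQ)//=.
    rewrite [X in _ = _ + X]big_nat_cond [X in _ = _ + X]big1 ?addr0// => k.
    rewrite andbT => /andP[Pk _].
    by rewrite /G sP// TX0 -(scale0r 0) ell2Z mul0r.
  move=> sM; rewrite /f -/G; have [NM|/ltnW MN] := leqP (N s) M.
    by rewrite (aux _ _ NM)//; exact: NP.
  by rewrite -(aux _ _ MN).
have TXD x y : x \in E -> y \in E -> TX (x + y) = TX x + TX y.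
  move=> Ex Ey; have -> : x = val (Sub x Ex : linear_subspace E) by rewrite SubK.
  have -> : y = val (Sub y Ey : linear_subspace E) by rewrite SubK.
  by rewrite -raddfD !TXE linearD.
have TXZ a x : x \in E -> TX (a *: x) = a *: TX x.
  move=> Ex; have -> : x = val (Sub x Ex : linear_subspace E) by rewrite SubK.
  by rewrite -linearZ !TXE linearZ.
have [||||g [gK gf]] := @hahn_banach _ _ _ F f (sublinear_tensor_norm K0).
- by move=> k; rewrite finseq0 rpred0.
- move=> s t Fs Ft; split=> [k|]; first by rewrite finseqD rpredD.
  pose M := maxn (N s) (N t).
  have sM k : (M <= k)%N -> seq_of s k = 0 by rewrite geq_max => /andP[? _]; exact: NP.
  have tM k : (M <= k)%N -> seq_of t k = 0 by rewrite geq_max => /andP[_ ?]; exact: NP.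
  rewrite (fE s M)// (fE t M)// (fE _ M) => [|k Mk]; last first.
    by rewrite finseqD sM// tM// addr0.
  by rewrite -big_split; apply: eq_bigr => k _; rewrite finseqD TXD// ell2D.
- move=> a s Fs; split=> [k|]; first by rewrite finseqZ rpredZ.
  rewrite (fE s (N s)); last exact: NP.
  rewrite (fE _ (N s)) => [|k Nk].
    rewrite mulr_sumr; apply: eq_bigr => k _.
    by rewrite finseqZ TXZ// ell2Z.
  by rewrite finseqZ NP// scaler0.
- move=> s Fs; rewrite -ler_pdivrMl//; apply: le_tensor_norm => W.
  move=> [W0 [n [x [y [xW y1 sE]]]]]; rewrite ler_pdivrMl//.
  apply: (HK n x y W (N s) (fun k => insubd 0 (seq_of s k))) => // k.
  by rewrite insubdK.
have [T' [sT' T'g]] := one_summing_of_functional K0 gK.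
exists T'; split=> // x; apply: ell2_ext => k.
(* A sequence with the single entry [x] at [k] lies in [F], and [f] takes there the value
   [T x k]. *)
rewrite T'g gf => [|j]; last by rewrite singleE; case: eqP; rewrite ?rpred0 ?(valP x).
rewrite (fE _ k.+1) => [|j kj]; last by rewrite singleE gtn_eqF.
rewrite big_ord_recr/= singleE eqxx TXE big1 ?add0r// => j _.
by rewrite singleE ltn_eqF ?ltn_ord// TX0 -(scale0r 0) ell2Z mul0r.
Qed.

(** The first factor is composed with the inclusion, which is isometric, so its bound persists. *)
Lemma factors_through_L1_restrict (T : {linear X -> ell2 R})
    (S : {linear linear_subspace E -> ell2 R}) :
  (forall x, T (val x) = S x) -> factors_through_L1 T -> factors_through_L1 S.
Proof.
move=> TS [disp [Om [nu [A [B [cA cB TBA]]]]]].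
pose A' : {linear linear_subspace E -> LspaceType1 nu} := A \o val.
exists disp, Om, nu, A', B; split=> // [|x]; last by rewrite -TS TBA.
have [a _ Aa] := continuous_linear_le cA.
by apply: (@linear_le_continuous _ _ _ _ a) => x; exact: Aa.
Qed.

End extension.

Theorem corollary2p3 (R : realType) (X : completeNormedModType R)
    (E : submodClosed X) (closedE : closed [set` E])
    (cotypeX : finite_cotype X) (GL2X : GL2 X) :
  GL2 (linear_subspace E) <->
  (forall T : {linear linear_subspace E -> ell2 R}, one_summing T ->
    exists T' : {linear X -> ell2 R},
      one_summing T' /\ (forall x : linear_subspace E, T' (val x) = T x)).
Proof.
split=> [GL2E T /GL2E|ext T /ext[T' [sT' T'T]]].
  exact: one_summing_extension.
exact: factors_through_L1_restrict T'T (GL2X T' sT').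
Qed.
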